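(* Let $L\subset\mathbb{C}$ be a nonempty closed set without isolated points. Then the set of continuous functions $u:L\to\mathbb{C}$ for which there exist no $z_0\in L$, $r>0$ and holomorphic $F:D(z_0,r)\to\mathbb{C}$ with $F=u$ on $D(z_0,r)\cap L$ is a dense $G_\delta$ subset of $C(L)$.
   Context: $C(L)$ is the space of continuous functions $L\to\mathbb{C}$ with the topology of uniform convergence on compact subsets of $L$ (for compact $L$, the sup-norm topology). $D(z_0,r)$ is the open disk of center $z_0$ and radius $r$. *)

(* Defs.v *)
From Stdlib Require Import Reals.
Open Scope R_scope.

Definition Cpx : Type := (R * R)%type.

Definition Cadd (z w : Cpx) : Cpx := (fst z + fst w, snd z + snd w).
Definition Csub (z w : Cpx) : Cpx := (fst z - fst w, snd z - snd w).
Definition Cmul (z w : Cpx) : Cpx :=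
  (fst z * fst w - snd z * snd w, fst z * snd w + snd z * fst w).
Definition Cnorm (z : Cpx) : R := sqrt (fst z * fst z + snd z * snd z).
Definition Cdist (z w : Cpx) : R := Cnorm (Csub z w).

Definition Cin_disk (z0 : Cpx) (r : R) (z : Cpx) : Prop := Cdist z z0 < r.

Definition Cclosed_set (L : Cpx -> Prop) : Prop :=
  forall z, (forall eps, 0 < eps -> exists w, L w /\ Cdist w z < eps) -> L z.

Definition Cbounded_set (K : Cpx -> Prop) : Prop :=
  exists M, forall z, K z -> Cnorm z <= M.

(* Compact subsets of Cpx (Heine–Borel: closed and bounded). *)
Definition Ccompact_set (K : Cpx -> Prop) : Prop := Cclosed_set K /\ Cbounded_set K.

Definition Cno_isolated_points (L : Cpx -> Prop) : Prop :=
  forall z, L z -> forall eps, 0 < eps -> exists w, L w /\ w <> z /\ Cdist w z < eps.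

(* Complex differentiability of F at z (division-free formulation). *)
Definition C_differentiable_at (F : Cpx -> Cpx) (z : Cpx) : Prop :=
  exists l : Cpx, forall eps, 0 < eps -> exists delta, 0 < delta /\
    forall h : Cpx, Cnorm h < delta ->
      Cnorm (Csub (Csub (F (Cadd z h)) (F z)) (Cmul l h)) <= eps * Cnorm h.

(* F is holomorphic on the open disk D(z0, r) (values outside are irrelevant). *)
Definition holomorphic_on_disk (F : Cpx -> Cpx) (z0 : Cpx) (r : R) : Prop :=
  forall z, Cin_disk z0 r z -> C_differentiable_at F z.

(* Elements of C(L): functions Cpx -> Cpx whose restriction to L is continuous
   (values off L are irrelevant). *)
Definition Ccontinuous_on (L : Cpx -> Prop) (u : Cpx -> Cpx) : Prop :=
  forall z, L z -> forall eps, 0 < eps -> exists delta, 0 < delta /\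
    forall w, L w -> Cdist w z < delta -> Cdist (u w) (u z) < eps.

(* Topology of uniform convergence on compact subsets of L. *)
Definition Cclose_on (K : Cpx -> Prop) (eps : R) (u v : Cpx -> Cpx) : Prop :=
  forall z, K z -> Cdist (v z) (u z) < eps.

Definition Csubset_of (K L : Cpx -> Prop) : Prop := forall z, K z -> L z.

Definition CL_open (L : Cpx -> Prop) (U : (Cpx -> Cpx) -> Prop) : Prop :=
  forall u, Ccontinuous_on L u -> U u ->
    exists K eps, Ccompact_set K /\ Csubset_of K L /\ 0 < eps /\
      forall v, Ccontinuous_on L v -> Cclose_on K eps u v -> U v.

Definition CL_dense (L : Cpx -> Prop) (A : (Cpx -> Cpx) -> Prop) : Prop :=
  forall u K eps, Ccontinuous_on L u -> Ccompact_set K -> Csubset_of K L -> 0 < eps ->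
    exists v, Ccontinuous_on L v /\ A v /\ Cclose_on K eps u v.

Definition CL_Gdelta (L : Cpx -> Prop) (A : (Cpx -> Cpx) -> Prop) : Prop :=
  exists U : nat -> (Cpx -> Cpx) -> Prop,
    (forall n, CL_open L (U n)) /\
    (forall v, Ccontinuous_on L v -> (A v <-> forall n, U n v)).

Definition nowhere_holomorphically_extendable (L : Cpx -> Prop) (u : Cpx -> Cpx) : Prop :=
  Ccontinuous_on L u /\
  ~ (exists z0 r F, L z0 /\ 0 < r /\ holomorphic_on_disk F z0 r /\
       forall z, Cin_disk z0 r z -> L z -> F z = u z).

(* Main.v *)
(** Let [zs] be a sequence of points of [L] that is dense in [L].

    Density.  The series [phi z = sum_n 4^-n min(1, sqrt|z - zs n|)] is continuous but not
    Lipschitz along [L] at any [zs k], whereas a function with a holomorphic extension is Lipschitz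
    at all points of [L] in the disk.  For each [k] at most one [t] makes [u + t phi] Lipschitz at
    [zs k], so all but countably many [t] give a nowhere extendable perturbation of [u].

    G_delta.  Goursat's bisection argument, applied to the homotopy between a circle around the
    origin and a small circle around [z], gives Cauchy's formula, and with it quantitative bounds:
    on a smaller disk [|F|, |F'| <= M] and [|F w - F z - F' z (w - z)| <= M |w - z|^2].  Such pairs
    [(F, F')] on a fixed disk, with a fixed [M], are compact for pointwise convergence, so the
    functions [u] extendable by one of them form a closed set.  The extendable functions are the
    union of countably many such sets. *)

Require Import Defs.
From mathcomp Require classical.filter.
From Stdlib Require Import Reals Lra Lia Classical ClassicalEpsilon.
From Stdlib Require Cantor.
From Coquelicot Require Import Coquelicot.
Open Scope R_scope.

(** * Nested intervals and additive rectangle functions *)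

(** The bound [M] is what makes extendability a closed condition: on a segment every continuous
    function is a uniform limit of polynomials, so limits of functions extendable to a fixed disk
    need not extend. Holomorphy provides only differentiability point by point, with no control of
    the derivative or of the remainder; Goursat's argument leads from there to constants valid on a
    whole disk. The bisection runs in the parameter rectangle of the homotopy, where cutting a
    rectangle just cuts two integrals over real intervals. The quadratic remainder is the form of
    holomorphy that is kept, because it is an inequality between finitely many values: it survives
    pointwise limits and still implies differentiability.

    In the density part the danger is cancellation. Each cusp has its minimum at its centre, so
    lower bounds for the increments can be added, and the ratio 1/4 keeps all later cusps together
    below a third of the one under inspection. The factor [t] deals with the remaining cancellation,
    between [phi] and [u]. *)

Lemma nested_intervals (a b : nat -> R) :
  (forall n, a n <= a (S n)) -> (forall n, b (S n) <= b n) -> (forall n, a n <= b n) ->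
  exists x, forall n, a n <= x <= b n.
Proof.
  intros Ha Hb Hab.
  assert (Ha' : forall n k, a n <= a (n + k)%nat).
  { intros n k; induction k as [|k IH]; [rewrite Nat.add_0_r; lra|].
    rewrite Nat.add_succ_r; generalize (Ha (n + k)%nat); lra. }
  assert (Hb' : forall n k, b (n + k)%nat <= b n).
  { intros n k; induction k as [|k IH]; [rewrite Nat.add_0_r; lra|].
    rewrite Nat.add_succ_r; generalize (Hb (n + k)%nat); lra. }
  assert (Hc : forall n m, a n <= b m).
  { intros n m; generalize (Ha' n m) (Hb' m n) (Hab (n + m)%nat).
    rewrite (Nat.add_comm m n); lra. }
  destruct (completeness (fun y => exists n, y = a n)) as [x [Hx1 Hx2]].
  - exists (b O); intros y [n ->]; apply Hc.
  - exists (a O), O; reflexivity.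
  - exists x; intros n; split.
    + apply Hx1; exists n; reflexivity.
    + apply Hx2; intros y [m ->]; apply Hc.
Qed.

Lemma pow_half_small (q d : R) : 0 < d -> exists n, q * (/ 2) ^ n < d.
Proof.
  intros Hd.
  destruct (Rle_dec q 0) as [Hq|Hq].
  { exists O; simpl; lra. }
  destruct (pow_lt_1_zero (/ 2)) with (y := d / q) as [n Hn].
  - rewrite Rabs_pos_eq; lra.
  - apply Rdiv_lt_0_compat; lra.
  - exists n. specialize (Hn n (Nat.le_refl n)).
    rewrite Rabs_pos_eq in Hn by (apply pow_le; lra).
    replace d with (q * (d / q)) by (field; lra).
    apply Rmult_lt_compat_l; lra.
Qed.

(** Bisection: some quarter of a rectangle carries at least a quarter of [Cmod J], and its
    half-perimeter is halved, so the ratio of [Cmod J] to the squared half-perimeter never decreases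
    along a suitable nested sequence. At the common point [(s, t)] the local hypothesis makes this
    ratio arbitrarily small. *)
Lemma additive_rectangle_function_zero (J : R -> R -> R -> R -> C) (a0 b0 c0 d0 : R) :
  a0 <= b0 -> c0 <= d0 ->
  (forall a m b c d, a0 <= a -> a <= m -> m <= b -> b <= b0 -> c0 <= c -> c <= d -> d <= d0 ->
     J a b c d = Cplus (J a m c d) (J m b c d)) ->
  (forall a b c m d, a0 <= a -> a <= b -> b <= b0 -> c0 <= c -> c <= m -> m <= d -> d <= d0 ->
     J a b c d = Cplus (J a b c m) (J a b m d)) ->
  (forall s t eps, a0 <= s <= b0 -> c0 <= t <= d0 -> 0 < eps ->
     exists delta, 0 < delta /\ forall a b c d,
       a0 <= a -> a <= s <= b -> b <= b0 -> c0 <= c -> c <= t <= d -> d <= d0 ->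
       b - a + (d - c) < delta ->
       Cmod (J a b c d) <= eps * (b - a + (d - c)) ^ 2) ->
  J a0 b0 c0 d0 = RtoC 0.
Proof.
  intros Hab Hcd Hx Hy Hloc.
  pose (N := fun p : (R * R) * (R * R) =>
    Cmod (J (fst (fst p)) (snd (fst p)) (fst (snd p)) (snd (snd p)))).
  pose (ok := fun p : (R * R) * (R * R) =>
    a0 <= fst (fst p) /\ fst (fst p) <= snd (fst p) /\ snd (fst p) <= b0 /\
    c0 <= fst (snd p) /\ fst (snd p) <= snd (snd p) /\ snd (snd p) <= d0).
  pose (sub := fun p q : (R * R) * (R * R) =>
    (fst (fst p) <= fst (fst q) /\ snd (fst q) <= snd (fst p) /\
     fst (snd p) <= fst (snd q) /\ snd (snd q) <= snd (snd p)) /\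
    snd (fst q) - fst (fst q) = (snd (fst p) - fst (fst p)) / 2 /\
    snd (snd q) - fst (snd q) = (snd (snd p) - fst (snd p)) / 2 /\
    N p <= 4 * N q).
  assert (Hstep : forall p, ok p -> exists q, ok q /\ sub p q).
  { intros [[a b] [c d]] (H1 & H2 & H3 & H4 & H5 & H6); simpl in *.
    set (m := (a + b) / 2). set (k := (c + d) / 2).
    assert (Hm : a <= m <= b) by (unfold m; lra).
    assert (Hk : c <= k <= d) by (unfold k; lra).
    assert (E : J a b c d = Cplus (Cplus (J a m c k) (J a m k d))
                                  (Cplus (J m b c k) (J m b k d))).
    { rewrite (Hx a m b c d), (Hy a m c k d), (Hy m b c k d); [reflexivity|lra..]. }
    assert (Htri : Cmod (J a b c d) <= Cmod (J a m c k) + Cmod (J a m k d)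
                     + (Cmod (J m b c k) + Cmod (J m b k d))).
    { rewrite E. eapply Rle_trans; [apply Cmod_triangle|].
      apply Rplus_le_compat; apply Cmod_triangle. }
    assert (Hpick : exists q, (q = ((a, m), (c, k)) \/ q = ((a, m), (k, d)) \/
        q = ((m, b), (c, k)) \/ q = ((m, b), (k, d))) /\ Cmod (J a b c d) <= 4 * N q).
    { destruct (Rle_dec (Cmod (J a b c d)) (4 * Cmod (J a m c k))).
      { exists ((a, m), (c, k)); auto. }
      destruct (Rle_dec (Cmod (J a b c d)) (4 * Cmod (J a m k d))).
      { exists ((a, m), (k, d)); auto. }
      destruct (Rle_dec (Cmod (J a b c d)) (4 * Cmod (J m b c k))).
      { exists ((m, b), (c, k)); auto. }
      exists ((m, b), (k, d)); split; auto. unfold N; simpl; lra. }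
    destruct Hpick as [q [Hq HN]]; exists q; unfold ok, sub.
    assert (HNp : N ((a, b), (c, d)) <= 4 * N q) by exact HN.
    destruct Hq as [-> | [-> | [-> | ->]]]; simpl; unfold m, k in *;
      repeat split; try exact HNp; lra. }
  pose (next := fun p => match excluded_middle_informative (ok p) with
    | left h => proj1_sig (constructive_indefinite_description _ (Hstep p h))
    | right _ => p end).
  assert (Hnext : forall p, ok p -> ok (next p) /\ sub p (next p)).
  { intros p hp; unfold next; destruct (excluded_middle_informative (ok p)) as [h|h];
      [|contradiction]. exact (proj2_sig (constructive_indefinite_description _ (Hstep p h))). }
  pose (P := fix P n := match n with O => ((a0, b0), (c0, d0)) | S n => next (P n) end).
  assert (Hok : forall n, ok (P n)).
  { induction n as [|n IH]; [unfold ok; simpl; lra | apply (Hnext _ IH)]. }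
  assert (Hsub : forall n, sub (P n) (P (S n))) by (intros n; apply (Hnext _ (Hok n))).
  assert (HP : forall n,
     snd (fst (P n)) - fst (fst (P n)) = (b0 - a0) * (/ 2) ^ n /\
     snd (snd (P n)) - fst (snd (P n)) = (d0 - c0) * (/ 2) ^ n /\
     N (P O) * ((/ 2) ^ n) ^ 2 <= N (P n)).
  { induction n as [|n IH]; [simpl; lra|].
    destruct (Hsub n) as (_ & H1 & H2 & H3); destruct IH as (I1 & I2 & I3).
    rewrite H1, H2, I1, I2. simpl pow in *.
    repeat split; [field | field | nra]. }
  destruct (nested_intervals (fun n => fst (fst (P n))) (fun n => snd (fst (P n))))
    as [s Hs]; try (intros n; destruct (Hsub n) as ((? & ? & ? & ?) & _); assumption).
  { intros n; apply (Hok n). }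
  destruct (nested_intervals (fun n => fst (snd (P n))) (fun n => snd (snd (P n))))
    as [t Ht]; try (intros n; destruct (Hsub n) as ((? & ? & ? & ?) & _); assumption).
  { intros n; apply (Hok n). }
  set (q := b0 - a0 + (d0 - c0)).
  (* After [n] steps both the lower bound for [N (P n)] and the upper bound from [Hloc] carry the
     factor [((/ 2) ^ n) ^ 2], which cancels. *)
  assert (Hz : forall eps, 0 < eps -> N (P O) <= eps * q ^ 2).
  { intros eps Heps.
    destruct (Hloc s t eps (Hs O) (Ht O) Heps) as (delta & Hd & HJ).
    destruct (pow_half_small q delta Hd) as [n Hn].
    destruct (HP n) as (H1 & H2 & H3). destruct (Hok n) as (K1 & K2 & K3 & K4 & K5 & K6).
    assert (HJn : N (P n) <= eps * (q * (/ 2) ^ n) ^ 2).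
    { replace (q * (/ 2) ^ n) with
        (snd (fst (P n)) - fst (fst (P n)) + (snd (snd (P n)) - fst (snd (P n))))
        by (rewrite H1, H2; unfold q; ring).
      apply HJ; auto. rewrite H1, H2. unfold q in Hn. lra. }
    assert (Hp : 0 < ((/ 2) ^ n) ^ 2) by (apply pow_lt, pow_lt; lra).
    apply Rmult_le_reg_r with (1 := Hp). nra. }
  apply Cmod_eq_0. change (N (P O) = 0).
  apply Rle_antisym; [|apply Cmod_ge_0].
  apply Rnot_lt_le; intros Hlt.
  assert (Hq : 0 <= q ^ 2) by (apply pow2_ge_0).
  (* This [eps] would give [N (P O) <= N (P O) / 2]; the [+ 1] covers [q = 0]. *)
  specialize (Hz (N (P O) / (2 * (q ^ 2 + 1)))).
  assert (0 < N (P O) / (2 * (q ^ 2 + 1))) by (apply Rdiv_lt_0_compat; lra).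
  specialize (Hz H).
  assert (N (P O) / (2 * (q ^ 2 + 1)) * (2 * (q^2 + 1)) = N (P O)) by (field; lra).
  nra.
Qed.

(** * Complex-valued functions of a real variable *)

Lemma Cmod_le_Rabs (z : C) : Cmod z <= Rabs (fst z) + Rabs (snd z).
Proof.
  destruct z as [x y]; unfold Cmod; simpl fst; simpl snd.
  apply Rsqr_incr_0_var; [|generalize (Rabs_pos x) (Rabs_pos y); lra].
  rewrite Rsqr_sqrt by nra. unfold Rsqr.
  generalize (Rabs_pos x) (Rabs_pos y) (pow2_abs x) (pow2_abs y); nra.
Qed.

Lemma Rabs_fst_le_Cmod (z : C) : Rabs (fst z) <= Cmod z.
Proof. eapply Rle_trans; [apply Rmax_l | apply Rmax_Cmod]. Qed.

Lemma Rabs_snd_le_Cmod (z : C) : Rabs (snd z) <= Cmod z.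
Proof. eapply Rle_trans; [apply Rmax_r | apply Rmax_Cmod]. Qed.

Lemma Cmod_minus_sym (z w : C) : Cmod (Cminus z w) = Cmod (Cminus w z).
Proof. rewrite <- Cmod_opp. f_equal. ring. Qed.

Lemma Cmod_triangle_minus (x y z : C) :
  Cmod (Cminus x z) <= Cmod (Cminus x y) + Cmod (Cminus y z).
Proof. replace (Cminus x z) with (Cplus (Cminus x y) (Cminus y z)) by ring. apply Cmod_triangle. Qed.

(** Continuity, derivative and integral are taken componentwise, so that the real theory of [RInt]
    and [is_derive] applies directly. *)
Definition ccont (f : R -> C) (x : R) : Prop :=
  continuous (fun t => fst (f t)) x /\ continuous (fun t => snd (f t)) x.

Definition cderive (f : R -> C) (x : R) (l : C) : Prop :=
  is_derive (fun t => fst (f t)) x (fst l) /\ is_derive (fun t => snd (f t)) x (snd l).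

Definition CInt (f : R -> C) (a b : R) : C :=
  (RInt (fun t => fst (f t)) a b, RInt (fun t => snd (f t)) a b).

Lemma continuous_eps (f : R -> R) x :
  continuous f x <->
  forall eps, 0 < eps -> exists d, 0 < d /\ forall y, Rabs (y - x) < d -> Rabs (f y - f x) < eps.
Proof.
  split.
  - intros H eps He. apply filterlim_locally with (eps := mkposreal eps He) in H.
    destruct H as [d Hd]; exists d; split; [apply cond_pos|]. exact Hd.
  - intros H. apply filterlim_locally; intros [eps He].
    destruct (H eps He) as (d & Hd & Hy). exists (mkposreal d Hd). exact Hy.
Qed.

Lemma ccont_eps (f : R -> C) x :
  ccont f x <->
  forall eps, 0 < eps -> exists d, 0 < d /\
    forall y, Rabs (y - x) < d -> Cmod (Cminus (f y) (f x)) < eps.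
Proof.
  unfold ccont; rewrite !continuous_eps; split.
  - intros [H1 H2] eps He.
    destruct (H1 (eps / 2)) as (d1 & Hd1 & K1); [lra|].
    destruct (H2 (eps / 2)) as (d2 & Hd2 & K2); [lra|].
    exists (Rmin d1 d2); split; [apply Rmin_pos; auto|]. intros y Hy.
    eapply Rle_lt_trans; [apply Cmod_le_Rabs|].
    generalize (K1 y (Rlt_le_trans _ _ _ Hy (Rmin_l _ _)))
      (K2 y (Rlt_le_trans _ _ _ Hy (Rmin_r _ _))). simpl. unfold Rminus; lra.
  - intros H; split; intros eps He; destruct (H eps He) as (d & Hd & K);
      exists d; split; auto; intros y Hy; eapply Rle_lt_trans; try apply (K y Hy).
    + apply (Rabs_fst_le_Cmod (Cminus (f y) (f x))).
    + apply (Rabs_snd_le_Cmod (Cminus (f y) (f x))).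
Qed.

Lemma ccont_const (c : C) x : ccont (fun _ => c) x.
Proof. split; apply continuous_const. Qed.

Lemma ccont_plus f g x : ccont f x -> ccont g x -> ccont (fun t => Cplus (f t) (g t)) x.
Proof. intros [] []; split; apply (continuous_plus (V := R_NormedModule)); auto. Qed.

Lemma ccont_mult f g x : ccont f x -> ccont g x -> ccont (fun t => Cmult (f t) (g t)) x.
Proof.
  intros [F1 F2] [G1 G2]; split; simpl.
  - apply (continuous_minus (V := R_NormedModule));
      apply (continuous_mult (K := R_AbsRing)); auto.
  - apply (continuous_plus (V := R_NormedModule));
      apply (continuous_mult (K := R_AbsRing)); auto.
Qed.

Lemma ccont_opp f x : ccont f x -> ccont (fun t => Copp (f t)) x.
Proof. intros []; split; apply (continuous_opp (V := R_NormedModule)); auto. Qed.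

Lemma ccont_minus f g x : ccont f x -> ccont g x -> ccont (fun t => Cminus (f t) (g t)) x.
Proof. intros; apply ccont_plus; [|apply ccont_opp]; auto. Qed.

Lemma ccont_Cmod_continuous f x : ccont f x -> continuous (fun t => Cmod (f t)) x.
Proof.
  rewrite ccont_eps, continuous_eps. intros H eps He. destruct (H eps He) as (d & Hd & K).
  exists d; split; auto; intros y Hy. eapply Rle_lt_trans; [|apply (K y Hy)].
  apply Rabs_le; split.
  - generalize (Cmod_triangle (Cminus (f x) (f y)) (f y)). rewrite (Cmod_minus_sym (f x)).
    replace (Cplus (Cminus (f x) (f y)) (f y)) with (f x) by ring. lra.
  - generalize (Cmod_triangle (Cminus (f y) (f x)) (f x)).
    replace (Cplus (Cminus (f y) (f x)) (f x)) with (f y) by ring. lra.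
Qed.

Lemma cderive_ccont f x l : cderive f x l -> ccont f x.
Proof.
  intros [H1 H2]; split; apply (ex_derive_continuous (K := R_AbsRing) (V := R_NormedModule));
    eexists; eassumption.
Qed.

Lemma cderive_const (c : C) x : cderive (fun _ => c) x 0.
Proof. split; apply (is_derive_const (K := R_AbsRing) (V := R_NormedModule)). Qed.

Lemma cderive_plus f g x l m : cderive f x l -> cderive g x m ->
  cderive (fun t => Cplus (f t) (g t)) x (Cplus l m).
Proof. intros [] []; split; apply (is_derive_plus (V := R_NormedModule)); auto. Qed.

Lemma cderive_mult f g x l m : cderive f x l -> cderive g x m ->
  cderive (fun t => Cmult (f t) (g t)) x (Cplus (Cmult l (g x)) (Cmult (f x) m)).
Proof.
  intros [F1 F2] [G1 G2]; split; simpl.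
  - evar_last.
    + apply (is_derive_minus (V := R_NormedModule));
        apply (is_derive_mult (K := R_AbsRing)); eauto; intros; apply Rmult_comm.
    + unfold minus, plus, opp, mult; simpl; ring.
  - evar_last.
    + apply (is_derive_plus (V := R_NormedModule));
        apply (is_derive_mult (K := R_AbsRing)); eauto; intros; apply Rmult_comm.
    + unfold minus, plus, opp, mult; simpl; ring.
Qed.

Lemma ccont_ex_RInt f a b : (forall x, Rmin a b <= x <= Rmax a b -> ccont f x) ->
  ex_RInt (fun t => fst (f t)) a b /\ ex_RInt (fun t => snd (f t)) a b.
Proof. intros H; split; apply (ex_RInt_continuous (V := R_CompleteNormedModule)); intros; apply H; auto. Qed.

Lemma ccont_ex_RInt_le f a b : a <= b -> (forall x, a <= x <= b -> ccont f x) ->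
  ex_RInt (fun t => fst (f t)) a b /\ ex_RInt (fun t => snd (f t)) a b.
Proof.
  intros Hab H; apply ccont_ex_RInt. rewrite Rmin_left, Rmax_right by auto. exact H.
Qed.

Lemma CInt_ext f g a b : a <= b -> (forall x, a <= x <= b -> f x = g x) -> CInt f a b = CInt g a b.
Proof.
  intros Hab H; unfold CInt; f_equal; apply RInt_ext; rewrite Rmin_left, Rmax_right by auto;
    intros; rewrite H; auto; lra.
Qed.

Lemma CInt_Chasles f a b c : a <= b <= c -> (forall x, a <= x <= c -> ccont f x) ->
  CInt f a c = Cplus (CInt f a b) (CInt f b c).
Proof.
  intros Hab H.
  destruct (ccont_ex_RInt_le f a b) as [A1 A2]; [lra | intros; apply H; lra |].
  destruct (ccont_ex_RInt_le f b c) as [B1 B2]; [lra | intros; apply H; lra |].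
  unfold CInt, Cplus; simpl; f_equal; symmetry;
    apply (RInt_Chasles (V := R_CompleteNormedModule)); auto.
Qed.

Lemma CInt_Cmult (c : C) f a b : a <= b -> (forall x, a <= x <= b -> ccont f x) ->
  CInt (fun t => Cmult c (f t)) a b = Cmult c (CInt f a b).
Proof.
  intros Hab Hf.
  destruct (ccont_ex_RInt_le f a b) as [A1 A2]; auto.
  assert (S1 : forall k g, ex_RInt g a b -> RInt (fun x => k * g x) a b = k * RInt g a b).
  { intros k g Hg. apply (RInt_scal (V := R_CompleteNormedModule)); auto. }
  assert (S2 : forall k g, ex_RInt g a b -> ex_RInt (fun x => k * g x) a b).
  { intros k g Hg. apply (ex_RInt_scal (V := R_NormedModule)); auto. }
  unfold CInt, Cmult; simpl; f_equal.
  - rewrite <- !S1 by auto.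
    apply (RInt_minus (V := R_CompleteNormedModule)); apply S2; auto.
  - rewrite <- !S1 by auto.
    apply (RInt_plus (V := R_CompleteNormedModule)); apply S2; auto.
Qed.

Lemma CInt_const (c : C) a b : CInt (fun _ => c) a b = Cmult (RtoC (b - a)) c.
Proof.
  unfold CInt, Cmult; simpl. rewrite !RInt_const. unfold scal; simpl; unfold mult; simpl.
  f_equal; ring.
Qed.

Lemma CInt_minus f g a b : a <= b -> (forall x, a <= x <= b -> ccont f x) ->
  (forall x, a <= x <= b -> ccont g x) ->
  CInt (fun t => Cminus (f t) (g t)) a b = Cminus (CInt f a b) (CInt g a b).
Proof.
  intros Hab Hf Hg.
  destruct (ccont_ex_RInt_le f a b) as [A1 A2]; auto.
  destruct (ccont_ex_RInt_le g a b) as [B1 B2]; auto.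
  unfold CInt, Cminus, Cplus, Copp; simpl; f_equal;
  apply (RInt_minus (V := R_CompleteNormedModule)); auto.
Qed.

(* Bounding the two components separately costs a factor 2, which is harmless for our purposes. *)
Lemma Cmod_CInt_le f a b M : a <= b -> (forall x, a <= x <= b -> ccont f x) ->
  (forall x, a <= x <= b -> Cmod (f x) <= M) -> Cmod (CInt f a b) <= 2 * (b - a) * M.
Proof.
  intros Hab Hf HM.
  destruct (ccont_ex_RInt_le f a b) as [A1 A2]; auto.
  eapply Rle_trans; [apply Cmod_le_Rabs|]. simpl.
  assert (Rabs (RInt (fun t => fst (f t)) a b) <= (b - a) * M).
  { apply abs_RInt_le_const; auto. intros; eapply Rle_trans; [apply Rabs_fst_le_Cmod|]; auto. }
  assert (Rabs (RInt (fun t => snd (f t)) a b) <= (b - a) * M).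
  { apply abs_RInt_le_const; auto. intros; eapply Rle_trans; [apply Rabs_snd_le_Cmod|]; auto. }
  lra.
Qed.

Lemma CInt_derive f df a b : a <= b -> (forall x, a <= x <= b -> cderive f x (df x)) ->
  (forall x, a <= x <= b -> ccont df x) -> CInt df a b = Cminus (f b) (f a).
Proof.
  intros Hab Hd Hc.
  unfold CInt; apply injective_projections; simpl.
  - apply is_RInt_unique, (is_RInt_derive (V := R_CompleteNormedModule) (fun t => fst (f t)));
      rewrite Rmin_left, Rmax_right by auto; intros; [apply Hd | apply Hc]; auto.
  - apply is_RInt_unique, (is_RInt_derive (V := R_CompleteNormedModule) (fun t => snd (f t)));
      rewrite Rmin_left, Rmax_right by auto; intros; [apply Hd | apply Hc]; auto.
Qed.

(** The mean value theorem fails for complex values, so the increment is written as the integral of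
    [df]; the factor 2 is that of [Cmod_CInt_le]. *)
Lemma cderive_lipschitz f df a b B : (forall x, a <= x <= b -> cderive f x (df x)) ->
  (forall x, a <= x <= b -> ccont df x) -> (forall x, a <= x <= b -> Cmod (df x) <= B) ->
  forall x y, a <= x <= b -> a <= y <= b -> Cmod (Cminus (f y) (f x)) <= 2 * B * Rabs (y - x).
Proof.
  intros Hd Hc HB.
  assert (H : forall x y, a <= x <= b -> a <= y <= b -> x <= y ->
    Cmod (Cminus (f y) (f x)) <= 2 * B * Rabs (y - x)).
  { intros x y Hx Hy Hxy.
    rewrite <- (CInt_derive f df) by (auto; intros; first [apply Hd | apply Hc]; lra).
    rewrite (Rabs_pos_eq (y - x)) by lra.
    replace (2 * B * (y - x)) with (2 * (y - x) * B) by ring.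
    apply Cmod_CInt_le; auto; intros; first [apply Hc | apply HB]; lra. }
  intros x y Hx Hy; destruct (Rle_dec x y) as [h|h]; [auto|].
  rewrite Cmod_minus_sym, Rabs_minus_sym. apply H; auto; lra.
Qed.

(** * Complex differentiability at a point, and the unit circle *)

Definition cdiff (F : C -> C) (z l : C) : Prop :=
  forall eps, 0 < eps -> exists delta, 0 < delta /\
    forall w, Cmod (Cminus w z) < delta ->
      Cmod (Cminus (Cminus (F w) (F z)) (Cmult l (Cminus w z))) <= eps * Cmod (Cminus w z).

Lemma cdiff_cont F z l : cdiff F z l ->
  forall eps, 0 < eps -> exists delta, 0 < delta /\
    forall w, Cmod (Cminus w z) < delta -> Cmod (Cminus (F w) (F z)) < eps.
Proof.
  intros H eps He. destruct (H 1 Rlt_0_1) as (d & Hd & K).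
  assert (Hl := Cmod_ge_0 l).
  assert (0 < eps / (2 + Cmod l)) by (apply Rdiv_lt_0_compat; lra).
  exists (Rmin d (eps / (2 + Cmod l))); split; [apply Rmin_pos; auto|].
  intros w Hw. specialize (K w (Rlt_le_trans _ _ _ Hw (Rmin_l _ _))).
  assert (Hw2 := Rlt_le_trans _ _ _ Hw (Rmin_r _ _)).
  replace (Cminus (F w) (F z)) with
    (Cplus (Cminus (Cminus (F w) (F z)) (Cmult l (Cminus w z))) (Cmult l (Cminus w z))) by ring.
  eapply Rle_lt_trans; [apply Cmod_triangle|]. rewrite Cmod_mult.
  assert (Hw0 := Cmod_ge_0 (Cminus w z)).
  apply Rle_lt_trans with ((2 + Cmod l) * Cmod (Cminus w z)); [lra|].
  replace eps with ((2 + Cmod l) * (eps / (2 + Cmod l))) by (field; lra).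
  apply Rmult_lt_compat_l; lra.
Qed.

Lemma ccont_comp (F : C -> C) (g : R -> C) x l : ccont g x -> cdiff F (g x) l ->
  ccont (fun t => F (g t)) x.
Proof.
  rewrite !ccont_eps. intros Hg HF eps He.
  destruct (cdiff_cont _ _ _ HF eps He) as (d & Hd & K).
  destruct (Hg d Hd) as (d' & Hd' & K'). exists d'; split; auto.
Qed.

Definition cis (t : R) : C := (cos t, sin t).

Lemma Cmod_cis t : Cmod (cis t) = 1.
Proof.
  unfold Cmod, cis; simpl fst; simpl snd.
  replace (cos t ^ 2 + sin t ^ 2) with 1; [apply sqrt_1|].
  generalize (sin2_cos2 t); unfold Rsqr; lra.
Qed.

Lemma cderive_cis t : cderive cis t (Cmult Ci (cis t)).
Proof. unfold cderive, cis; simpl; split; auto_derive; auto; ring. Qed.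

Lemma cderive_affine (p q : R) s : cderive (fun s => RtoC (p + s * q)) s (RtoC q).
Proof. unfold cderive, RtoC; simpl; split; auto_derive; auto; ring. Qed.

#[local] Opaque ccont cderive CInt.

(** * Goursat's theorem *)

(* The integral of [H(w) dw] along the boundary of the image of [[a,b] x [c,d]] under [Phi]. *)
Definition bdry_int (Phi Phis Phit : R -> R -> C) (H : C -> C) (a b c d : R) : C :=
  Cminus
    (Cplus (CInt (fun s => Cmult (H (Phi s c)) (Phis s c)) a b)
           (CInt (fun t => Cmult (H (Phi b t)) (Phit b t)) c d))
    (Cplus (CInt (fun s => Cmult (H (Phi s d)) (Phis s d)) a b)
           (CInt (fun t => Cmult (H (Phi a t)) (Phit a t)) c d)).

Section Goursat.

Variables (Phi Phis Phit : R -> R -> C) (a0 b0 c0 d0 B : R).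
Hypothesis Hab : a0 <= b0.
Hypothesis Hcd : c0 <= d0.
Hypothesis Hs : forall s t, a0 <= s <= b0 -> c0 <= t <= d0 ->
  cderive (fun s => Phi s t) s (Phis s t).
Hypothesis Ht : forall s t, a0 <= s <= b0 -> c0 <= t <= d0 ->
  cderive (fun t => Phi s t) t (Phit s t).
Hypothesis Hsc : forall s t, a0 <= s <= b0 -> c0 <= t <= d0 -> ccont (fun s => Phis s t) s.
Hypothesis Htc : forall s t, a0 <= s <= b0 -> c0 <= t <= d0 -> ccont (fun t => Phit s t) t.
Hypothesis HsB : forall s t, a0 <= s <= b0 -> c0 <= t <= d0 -> Cmod (Phis s t) <= B.
Hypothesis HtB : forall s t, a0 <= s <= b0 -> c0 <= t <= d0 -> Cmod (Phit s t) <= B.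

(** Moving from [(s, t)] through [(s, t')] to [(s', t')] changes one parameter at a time, so each
    partial derivative is integrated along its own variable. *)
Lemma bdry_int_param_lipschitz s t s' t' :
  a0 <= s <= b0 -> c0 <= t <= d0 -> a0 <= s' <= b0 -> c0 <= t' <= d0 ->
  Cmod (Cminus (Phi s' t') (Phi s t)) <= 2 * B * (Rabs (s' - s) + Rabs (t' - t)).
Proof.
  intros h1 h2 h3 h4.
  eapply Rle_trans; [apply (Cmod_triangle_minus _ (Phi s t'))|].
  rewrite Rmult_plus_distr_l. apply Rplus_le_compat.
  - apply (cderive_lipschitz (fun s => Phi s t') (fun s => Phis s t') a0 b0); auto.
  - apply (cderive_lipschitz (fun t => Phi s t) (fun t => Phit s t) c0 d0); auto.
Qed.

(** Separate continuity suits the integrals at hand, which all run along horizontal or vertical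
    segments of the parameter rectangle. *)
Definition ccont_on_rect (H : C -> C) : Prop := forall s t, a0 <= s <= b0 -> c0 <= t <= d0 ->
  ccont (fun s => H (Phi s t)) s /\ ccont (fun t => H (Phi s t)) t.

Lemma bdry_int_minus H K a b c d : ccont_on_rect H -> ccont_on_rect K ->
  a0 <= a -> a <= b -> b <= b0 -> c0 <= c -> c <= d -> d <= d0 ->
  bdry_int Phi Phis Phit (fun w => Cminus (H w) (K w)) a b c d =
  Cminus (bdry_int Phi Phis Phit H a b c d) (bdry_int Phi Phis Phit K a b c d).
Proof.
  intros hH hK h1 h2 h3 h4 h5 h6.
  assert (E : forall f g h x y, x <= y -> (forall z, x <= z <= y -> ccont f z) ->
    (forall z, x <= z <= y -> ccont g z) -> (forall z, x <= z <= y -> ccont h z) ->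
    CInt (fun z => Cmult (Cminus (f z) (g z)) (h z)) x y =
    Cminus (CInt (fun z => Cmult (f z) (h z)) x y) (CInt (fun z => Cmult (g z) (h z)) x y)).
  { intros f g h x y Hxy hf hg hh.
    rewrite <- CInt_minus by (auto; intros; apply ccont_mult; auto).
    apply CInt_ext; auto; intros; ring. }
  unfold bdry_int.
  rewrite (E (fun s => H (Phi s c)) (fun s => K (Phi s c)) (fun s => Phis s c)),
    (E (fun s => H (Phi s d)) (fun s => K (Phi s d)) (fun s => Phis s d)),
    (E (fun t => H (Phi a t)) (fun t => K (Phi a t)) (fun t => Phit a t)),
    (E (fun t => H (Phi b t)) (fun t => K (Phi b t)) (fun t => Phit b t));
    try (intros; first [apply hH | apply hK | apply Hsc | apply Htc]; lra); auto.
  ring.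
Qed.

(** Each of the four sides contributes [2 * (M * B)] times its length, the 2 coming from
    [Cmod_CInt_le]. *)
Lemma bdry_int_le H a b c d M : ccont_on_rect H ->
  a0 <= a -> a <= b -> b <= b0 -> c0 <= c -> c <= d -> d <= d0 -> 0 <= M ->
  (forall s t, a <= s <= b -> c <= t <= d -> Cmod (H (Phi s t)) <= M) ->
  Cmod (bdry_int Phi Phis Phit H a b c d) <= 4 * (b - a + (d - c)) * (M * B).
Proof.
  intros hH h1 h2 h3 h4 h5 h6 hM HM.
  assert (E1 : forall t, c <= t <= d ->
    Cmod (CInt (fun s => Cmult (H (Phi s t)) (Phis s t)) a b) <= 2 * (b - a) * (M * B)).
  { intros t Htt. apply Cmod_CInt_le; auto; intros x Hx.
    - apply ccont_mult; [apply hH | apply Hsc]; lra.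
    - rewrite Cmod_mult. apply Rmult_le_compat; try apply Cmod_ge_0; [apply HM; lra|apply HsB; lra]. }
  assert (E2 : forall s, a <= s <= b ->
    Cmod (CInt (fun t => Cmult (H (Phi s t)) (Phit s t)) c d) <= 2 * (d - c) * (M * B)).
  { intros t Htt. apply Cmod_CInt_le; auto; intros x Hx.
    - apply ccont_mult; [apply hH | apply Htc]; lra.
    - rewrite Cmod_mult. apply Rmult_le_compat; try apply Cmod_ge_0; [apply HM; lra|apply HtB; lra]. }
  unfold bdry_int.
  eapply Rle_trans; [apply Cmod_triangle|]. rewrite Cmod_opp.
  generalize (Cmod_triangle (CInt (fun s => Cmult (H (Phi s c)) (Phis s c)) a b)
           (CInt (fun t => Cmult (H (Phi b t)) (Phit b t)) c d)).
  generalize (Cmod_triangle (CInt (fun s => Cmult (H (Phi s d)) (Phis s d)) a b)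
           (CInt (fun t => Cmult (H (Phi a t)) (Phit a t)) c d)).
  generalize (E1 c) (E1 d) (E2 a) (E2 b). intros F1 F2 F3 F4.
  specialize (F1 ltac:(lra)). specialize (F2 ltac:(lra)).
  specialize (F3 ltac:(lra)). specialize (F4 ltac:(lra)). lra.
Qed.

Lemma affine_ccont_on_rect (p l w0 : C) :
  ccont_on_rect (fun w => Cplus p (Cmult l (Cminus w w0))).
Proof.
  intros s t h1 h2; split; apply ccont_plus; try apply ccont_const; apply ccont_mult;
    try apply ccont_const; apply ccont_minus; try apply ccont_const.
  - eapply cderive_ccont, Hs; auto.
  - eapply cderive_ccont, Ht; auto.
Qed.

Lemma bdry_int_affine (p l w0 : C) a b c d :
  a0 <= a -> a <= b -> b <= b0 -> c0 <= c -> c <= d -> d <= d0 ->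
  bdry_int Phi Phis Phit (fun w => Cplus p (Cmult l (Cminus w w0))) a b c d = 0.
Proof.
  intros h1 h2 h3 h4 h5 h6.
  (* A primitive of the affine integrand: each side then gives a difference of values of [A] at two
     corners, and these telescope around the boundary. *)
  pose (A := fun w => Cplus (Cmult p w) (Cmult (Cmult (Cmult l (/ 2)%R) (Cminus w w0)) (Cminus w w0))).
  assert (D : forall f x m, cderive f x m ->
    cderive (fun t => A (f t)) x (Cmult (Cplus p (Cmult l (Cminus (f x) w0))) m)).
  { intros f x m Hf.
    assert (Hf0 : cderive (fun t => Cminus (f t) w0) x m).
    { replace m with (Cplus m 0) by ring. apply cderive_plus; auto. apply cderive_const. }
    evar (L : C). assert (HL : cderive (fun t => A (f t)) x L).
    { apply cderive_plus; [apply cderive_mult; [apply cderive_const | exact Hf]|].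
      apply cderive_mult; [|exact Hf0]. apply cderive_mult; [apply cderive_const | exact Hf0]. }
    replace (Cmult (Cplus p (Cmult l (Cminus (f x) w0))) m) with L; [exact HL|].
    unfold L. destruct p, l, w0, m, (f x). unfold Cplus, Cmult, Cminus, Copp, RtoC; simpl.
    f_equal; field. }
  assert (E1 : forall t, c <= t <= d ->
    CInt (fun s => Cmult (Cplus p (Cmult l (Cminus (Phi s t) w0))) (Phis s t)) a b
      = Cminus (A (Phi b t)) (A (Phi a t))).
  { intros t h. apply (CInt_derive (fun s => A (Phi s t))); auto; intros x Hx.
    - apply (D (fun s => Phi s t)), Hs; lra.
    - apply ccont_mult; [apply affine_ccont_on_rect | apply Hsc]; lra. }
  assert (E2 : forall s, a <= s <= b ->
    CInt (fun t => Cmult (Cplus p (Cmult l (Cminus (Phi s t) w0))) (Phit s t)) c d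
      = Cminus (A (Phi s d)) (A (Phi s c))).
  { intros t h. apply (CInt_derive (fun s => A (Phi t s))); auto; intros x Hx.
    - apply (D (fun s => Phi t s)), Ht; lra.
    - apply ccont_mult; [apply affine_ccont_on_rect | apply Htc]; lra. }
  unfold bdry_int. rewrite !E1, !E2 by lra. ring.
Qed.

(** Near [Phi s t] the function [H] differs from its affine approximation [T] by a small multiple of
    the distance, and [T] has boundary integral zero. A rectangle of half-perimeter [q] has an image
    of size [O(q)], so its boundary integral is [o(q ^ 2)], as the bisection lemma requires. *)
Lemma goursat_parametrised (H : C -> C) :
  (forall s t, a0 <= s <= b0 -> c0 <= t <= d0 -> exists l, cdiff H (Phi s t) l) ->
  bdry_int Phi Phis Phit H a0 b0 c0 d0 = 0.
Proof.
  intros HH.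
  assert (hH : ccont_on_rect H).
  { intros s t h1 h2; destruct (HH s t h1 h2) as [l Hl]; split.
    - apply (ccont_comp H (fun s => Phi s t)) with l; auto. eapply cderive_ccont, Hs; auto.
    - apply (ccont_comp H (fun t => Phi s t)) with l; auto. eapply cderive_ccont, Ht; auto. }
  assert (HB : 0 <= B).
  { eapply Rle_trans; [apply Cmod_ge_0 | apply (HsB a0 c0)]; lra. }
  apply additive_rectangle_function_zero; auto.
  - intros a m b c d h1 h2 h3 h4 h5 h6 h7. unfold bdry_int.
    rewrite (CInt_Chasles (fun s => Cmult (H (Phi s c)) (Phis s c)) a m b),
      (CInt_Chasles (fun s => Cmult (H (Phi s d)) (Phis s d)) a m b)
      by (try lra; intros; apply ccont_mult; first [apply hH | apply Hsc]; lra).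
    ring.
  - intros a b c m d h1 h2 h3 h4 h5 h6 h7. unfold bdry_int.
    rewrite (CInt_Chasles (fun t => Cmult (H (Phi a t)) (Phit a t)) c m d),
      (CInt_Chasles (fun t => Cmult (H (Phi b t)) (Phit b t)) c m d)
      by (try lra; intros; apply ccont_mult; first [apply hH | apply Htc]; lra).
    ring.
  - intros s t eps h1 h2 Heps. destruct (HH s t h1 h2) as [l Hl].
    (* The estimate below ends with [8 * B * B * e * q ^ 2]; the [+ 1] covers [B = 0], here and in
       [delta / (2 * B + 1)]. *)
    set (e := eps / (8 * B * B + 1)).
    assert (He : 0 < e) by (apply Rdiv_lt_0_compat; nra).
    destruct (Hl e He) as (delta & Hd & K).
    exists (delta / (2 * B + 1)); split; [apply Rdiv_lt_0_compat; lra|].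
    intros a b c d k1 k2 k3 k4 k5 k6 k7.
    set (q := b - a + (d - c)) in *.
    assert (Hq : 0 <= q) by (unfold q; lra).
    assert (Hqd : 2 * B * q < delta).
    { apply Rle_lt_trans with ((2 * B + 1) * q); [lra|].
      replace delta with ((2 * B + 1) * (delta / (2 * B + 1))) by (field; lra).
      apply Rmult_lt_compat_l; lra. }
    set (T := fun w => Cplus (H (Phi s t)) (Cmult l (Cminus w (Phi s t)))).
    assert (hT : ccont_on_rect T) by apply affine_ccont_on_rect.
    replace (bdry_int Phi Phis Phit H a b c d) with
      (bdry_int Phi Phis Phit (fun w => Cminus (H w) (T w)) a b c d).
    2:{ rewrite bdry_int_minus by (auto; lra). unfold T; rewrite bdry_int_affine by lra. ring. }
    eapply Rle_trans; [apply (bdry_int_le _ a b c d (e * (2 * B * q))); try lra|].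
    + intros s' t' h1' h2'; destruct (hH s' t' h1' h2'), (hT s' t' h1' h2');
        split; apply ccont_minus; auto.
    + apply Rmult_le_pos; nra.
    + intros s' t' h1' h2'.
      assert (HL : Cmod (Cminus (Phi s' t') (Phi s t)) <= 2 * B * q).
      { eapply Rle_trans; [apply bdry_int_param_lipschitz; lra|].
        apply Rmult_le_compat_l; [lra|]. unfold q.
        apply Rplus_le_compat; apply Rabs_le; lra. }
      replace (Cminus (H (Phi s' t')) (T (Phi s' t'))) with
        (Cminus (Cminus (H (Phi s' t')) (H (Phi s t))) (Cmult l (Cminus (Phi s' t') (Phi s t))))
        by (unfold T; ring).
      eapply Rle_trans; [apply K; lra|]. apply Rmult_le_compat_l; lra.
    + fold q. assert (Hee : e * (8 * B * B + 1) = eps) by (unfold e; field; nra).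
      rewrite <- Hee. replace (4 * q * (e * (2 * B * q) * B)) with (e * (8 * B * B) * q ^ 2) by ring.
      apply Rmult_le_compat_r; [apply pow2_ge_0|]. nra.
Qed.

End Goursat.

(** * Cauchy's integral formula *)

Lemma Cmod_minus_ge (z w : C) : Cmod z - Cmod w <= Cmod (Cminus z w).
Proof.
  generalize (Cmod_triangle (Cminus z w) w). replace (Cplus (Cminus z w) w) with z by ring. lra.
Qed.

Lemma Cmod_plus_ge (z w : C) : Cmod z - Cmod w <= Cmod (Cplus z w).
Proof.
  replace (Cplus z w) with (Cminus z (Copp w)) by ring.
  rewrite <- (Cmod_opp w). apply Cmod_minus_ge.
Qed.

Lemma Cmod_pos_neq0 (z : C) : 0 < Cmod z -> z <> 0.
Proof. intros H ->. rewrite Cmod_0 in H; lra. Qed.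

(** The quotient rule. With [q = w - z], [h = v - w] and [e] the error of [F], the error of the
    quotient is exactly [(e - m h^2) / (q + h)]. The denominator has modulus at least [Cmod q / 2],
    so it suffices to bound each term of the numerator by [eps * Cmod q / 4 * Cmod h]. *)
Lemma cdiff_div_minus F w z l : w <> z -> cdiff F w l ->
  exists m, cdiff (fun v => Cdiv (F v) (Cminus v z)) w m.
Proof.
  intros Hwz HF.
  set (q := Cminus w z).
  assert (Hq0 : q <> 0).
  { intros E. apply Hwz. replace w with (Cplus q z) by (unfold q; ring). rewrite E; ring. }
  assert (Hq : 0 < Cmod q) by (apply Cmod_gt_0; auto).
  set (m := Cdiv (Cminus (Cmult l q) (F w)) (Cmult q q)).
  exists m. intros eps Heps.
  destruct (HF (eps * Cmod q / 4)) as (d & Hd & K); [nra|].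
  assert (Hm := Cmod_ge_0 m).
  set (d2 := eps * Cmod q / (4 * (Cmod m + 1))).
  assert (Hd2 : 0 < d2) by (apply Rdiv_lt_0_compat; nra).
  exists (Rmin d (Rmin (Cmod q / 2) d2)); split; [repeat apply Rmin_pos; lra|].
  intros v Hv.
  assert (V1 := Rlt_le_trans _ _ _ Hv (Rmin_l _ _)).
  assert (V := Rlt_le_trans _ _ _ Hv (Rmin_r _ _)).
  assert (V2 := Rlt_le_trans _ _ _ V (Rmin_l _ _)).
  assert (V3 := Rlt_le_trans _ _ _ V (Rmin_r _ _)).
  set (h := Cminus v w) in *.
  assert (Ev : Cminus v z = Cplus q h) by (unfold q, h; ring).
  assert (Hqh : Cmod q / 2 <= Cmod (Cplus q h)).
  { generalize (Cmod_plus_ge q h); lra. }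
  assert (Hqh0 : Cplus q h <> 0) by (apply Cmod_pos_neq0; lra).
  rewrite Ev. fold q.
  specialize (K v V1). fold h in K.
  set (e := Cminus (Cminus (F v) (F w)) (Cmult l h)) in *.
  replace (F v) with (Cplus (Cplus (F w) (Cmult l h)) e) by (unfold e; ring).
  replace (Cminus (Cminus (Cdiv (Cplus (Cplus (F w) (Cmult l h)) e) (Cplus q h)) (Cdiv (F w) q)) (Cmult m h))
    with (Cdiv (Cminus e (Cmult m (Cmult h h))) (Cplus q h)) by (unfold m; field; auto).
  rewrite Cmod_div by auto.
  apply Rle_div_l; [lra|].
  eapply Rle_trans; [apply Cmod_triangle|]. rewrite Cmod_opp, !Cmod_mult.
  assert (Hh := Cmod_ge_0 h).
  assert (X : Cmod m * Cmod h <= eps * Cmod q / 4).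
  { apply Rle_trans with ((Cmod m + 1) * d2); [nra|].
    right; unfold d2; field; lra. }
  assert (Y : Cmod m * (Cmod h * Cmod h) <= eps * Cmod q / 4 * Cmod h) by nra.
  assert (Z : eps * Cmod h * (Cmod q / 2) <= eps * Cmod h * Cmod (Cplus q h)).
  { apply Rmult_le_compat_l; [nra|auto]. }
  lra.
Qed.

Definition circle (z : C) (r t : R) : C := Cplus z (Cmult r (cis t)).

Lemma ccont_circle z r t : ccont (circle z r) t.
Proof.
  apply ccont_plus; [apply ccont_const | apply ccont_mult; [apply ccont_const|]].
  eapply cderive_ccont, cderive_cis.
Qed.

Lemma Cmod_circle_minus z r t : 0 <= r -> Cmod (Cminus (circle z r t) z) = r.
Proof.
  intros Hr. unfold circle. replace (Cminus (Cplus z (Cmult r (cis t))) z) with (Cmult r (cis t)) by ring.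
  rewrite Cmod_mult, Cmod_cis, Cmod_R, Rabs_pos_eq; lra.
Qed.

(* Homotopy between the circle of radius [rho] around [0] and the circle of radius [e] around [z],
   avoiding [z] itself. *)
Definition homot (z : C) (e rho s t : R) : C :=
  Cplus (Cmult (RtoC (1 + s * -1)) z) (Cmult (RtoC (e + s * (rho - e))) (cis t)).

(** Both sides are the integral of [F w / (w - z) dw] divided by [Ci]. On the circle around 0 one
    has [dw = i w dt], whence the kernel [w / (w - z)]; on the small circle [dw / (w - z) = i dt],
    so only [F] remains. *)
Lemma cauchy_homotopy (F : C -> C) (rho e : R) (z : C) :
  (forall w, Cmod w <= rho -> exists l, cdiff F w l) -> 0 < e <= rho - Cmod z ->
  CInt (fun t => Cmult (F (circle 0 rho t)) (Cdiv (circle 0 rho t) (Cminus (circle 0 rho t) z)))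
    0 (2 * PI) =
  CInt (fun t => F (circle z e t)) 0 (2 * PI).
Proof.
  intros HF He. assert (Hz := Cmod_ge_0 z).
  assert (Hpi := PI_RGT_0).
  set (H := fun w => Cdiv (F w) (Cminus w z)).
  set (Phis := fun s t : R => Cplus (Cmult (RtoC (-1)) z) (Cmult (RtoC (rho - e)) (cis t))).
  set (Phit := fun s t : R => Cmult (RtoC (e + s * (rho - e))) (Cmult Ci (cis t))).
  assert (Hin : forall s t, 0 <= s <= 1 -> Cmod (homot z e rho s t) <= rho).
  { intros s t Hs. unfold homot. eapply Rle_trans; [apply Cmod_triangle|].
    rewrite !Cmod_mult, Cmod_cis, !Cmod_R, !Rabs_pos_eq by nra. nra. }
  (* Meeting [z] would force [e + s * (rho - e) <= s * Cmod z], impossible since [e > 0] and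
     [rho > Cmod z]. *)
  assert (Hne : forall s t, 0 <= s <= 1 -> homot z e rho s t <> z).
  { intros s t Hs E.
    assert (E' : Cminus (Cmult (RtoC (e + s * (rho - e))) (cis t)) (Cmult s z) = 0).
    { replace (RtoC 0) with (Cminus (homot z e rho s t) z) by (rewrite E; ring).
      unfold homot. replace (1 + s * -1) with (1 - s) by ring. rewrite RtoC_minus. ring. }
    assert (L := Cmod_minus_ge (Cmult (RtoC (e + s * (rho - e))) (cis t)) (Cmult s z)).
    rewrite E', Cmod_0, !Cmod_mult, Cmod_cis, !Cmod_R, !Rabs_pos_eq in L by nra. nra. }
  assert (G : bdry_int (homot z e rho) Phis Phit H 0 1 0 (2 * PI) = 0).
  { apply goursat_parametrised with (B := Cmod z + 2 * rho); try lra.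
    - intros s t _ _. unfold homot, Phis.
      replace (Cplus (Cmult (RtoC (-1)) z) (Cmult (RtoC (rho - e)) (cis t))) with
        (Cplus (Cplus (Cmult (RtoC (-1)) z) (Cmult (RtoC (1 + s * -1)) 0))
          (Cplus (Cmult (RtoC (rho - e)) (cis t)) (Cmult (RtoC (e + s * (rho - e))) 0))) by ring.
      apply cderive_plus.
      + apply (cderive_mult (fun s => RtoC (1 + s * -1)) (fun _ => z));
          [apply cderive_affine | apply cderive_const].
      + apply (cderive_mult (fun s => RtoC (e + s * (rho - e))) (fun _ => cis t));
          [apply cderive_affine | apply cderive_const].
    - intros s t _ _. unfold homot, Phit.
      replace (Cmult (RtoC (e + s * (rho - e))) (Cmult Ci (cis t))) with
       (Cplus 0 (Cplus (Cmult 0 (cis t)) (Cmult (RtoC (e + s * (rho - e))) (Cmult Ci (cis t))))) by ring.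
      apply cderive_plus; [apply cderive_const|].
      apply (cderive_mult (fun _ => RtoC (e + s * (rho - e))) cis);
        [apply cderive_const | apply cderive_cis].
    - intros s t _ _. apply (ccont_const (Phis s t)).
    - intros s t _ _. apply ccont_mult; [apply ccont_const|].
      apply ccont_mult; [apply ccont_const|]. eapply cderive_ccont, cderive_cis.
    - intros s t _ _. unfold Phis. eapply Rle_trans; [apply Cmod_triangle|].
      rewrite !Cmod_mult, Cmod_cis, !Cmod_R, (Rabs_pos_eq (rho - e)), (Rabs_left (-1)) by lra. lra.
    - intros s t Hs _. unfold Phit.
      rewrite !Cmod_mult, Cmod_cis, Cmod_R, Rabs_pos_eq by nra.
      replace (Cmod Ci) with 1; [nra|].
      unfold Cmod, Ci; simpl. replace (0 * (0 * 1) + 1 * (1 * 1)) with 1 by ring. now rewrite sqrt_1.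
    - intros s t Hs _. destruct (HF _ (Hin s t Hs)) as [l Hl].
      apply cdiff_div_minus with l; auto. }
  unfold bdry_int in G.
  (* By periodicity the sides [t = 0] and [t = 2 * PI] cancel, which leaves the integrals over the
     two circles. *)
  assert (P : forall s, homot z e rho s (2 * PI) = homot z e rho s 0 /\ Phis s (2 * PI) = Phis s 0).
  { intros s; unfold homot, Phis. replace (cis (2 * PI)) with (cis 0); [auto|].
    unfold cis. now rewrite cos_2PI, sin_2PI, cos_0, sin_0. }
  rewrite (CInt_ext (fun s => Cmult (H (homot z e rho s (2 * PI))) (Phis s (2 * PI)))
    (fun s => Cmult (H (homot z e rho s 0)) (Phis s 0))) in G
    by (try lra; intros s _; destruct (P s) as [-> ->]; auto).
  set (I1 := CInt (fun t => Cmult (H (homot z e rho 1 t)) (Phit 1 t)) 0 (2 * PI)) in *.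
  set (I0 := CInt (fun t => Cmult (H (homot z e rho 0 t)) (Phit 0 t)) 0 (2 * PI)) in *.
  assert (E : I1 = I0).
  { match type of G with Cminus (Cplus ?u _) _ = _ =>
      replace I1 with (Cplus (Cminus (Cplus u I1) (Cplus u I0)) I0) by ring end.
    rewrite G. ring. }
  assert (Hh1 : forall t, homot z e rho 1 t = circle 0 rho t).
  { intros t. unfold homot, circle.
    replace (1 + 1 * -1) with 0 by ring. replace (e + 1 * (rho - e)) with rho by ring. ring. }
  assert (Hh0 : forall t, homot z e rho 0 t = circle z e t).
  { intros t. unfold homot, circle.
    replace (1 + 0 * -1) with 1 by ring. replace (e + 0 * (rho - e)) with e by ring. ring. }
  assert (D : forall t, 0 <= t <= 2 * PI -> ccont (fun t => F (circle 0 rho t)) t).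
  { intros t Ht. destruct (HF (circle 0 rho t)) as [l Hl].
    { rewrite <- Hh1. apply Hin. lra. }
    apply (ccont_comp F (circle 0 rho)) with l; auto. apply ccont_circle. }
  assert (D0 : forall t, 0 <= t <= 2 * PI -> ccont (fun t => F (circle z e t)) t).
  { intros t Ht. destruct (HF (circle z e t)) as [l Hl].
    { rewrite <- Hh0. apply Hin. lra. }
    apply (ccont_comp F (circle z e)) with l; auto. apply ccont_circle. }
  assert (Hz1 : forall t, Cminus (circle 0 rho t) z <> 0).
  { intros t E'. apply (Hne 1 t); [lra|]. rewrite Hh1.
    replace (circle 0 rho t) with (Cplus (Cminus (circle 0 rho t) z) z) by ring. rewrite E'; ring. }
  assert (Hk : forall t, 0 <= t <= 2 * PI -> ccont (fun t => H (circle 0 rho t)) t).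
  { intros t Ht. destruct (HF (circle 0 rho t)) as [l Hl].
    { rewrite <- Hh1. apply Hin. lra. }
    destruct (cdiff_div_minus F (circle 0 rho t) z l) as [m Hm]; auto.
    { rewrite <- Hh1. apply Hne; lra. }
    apply (ccont_comp H (circle 0 rho)) with m; auto. apply ccont_circle. }
  set (J1 := CInt (fun t => Cmult (F (circle 0 rho t))
     (Cdiv (circle 0 rho t) (Cminus (circle 0 rho t) z))) 0 (2 * PI)).
  set (J0 := CInt (fun t => F (circle z e t)) 0 (2 * PI)).
  assert (X1 : I1 = Cmult Ci J1).
  { unfold I1, J1. rewrite <- CInt_Cmult; try lra.
    - apply CInt_ext; try lra. intros t _. rewrite Hh1. unfold H, Phit.
      replace (e + 1 * (rho - e)) with rho by ring.
      replace (Cdiv (circle 0 rho t)) with (Cdiv (Cmult rho (cis t)))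
        by (unfold circle; f_equal; ring).
      field. apply Hz1.
    - intros t Ht.
      assert (Q : ccont (fun t => Cmult (H (circle 0 rho t)) (circle 0 rho t)) t)
        by (apply ccont_mult; auto; apply ccont_circle).
      revert Q. rewrite !ccont_eps. intros Q eps Heps. destruct (Q eps Heps) as (d & Hd & Q').
      exists d; split; auto. intros y Hy. specialize (Q' y Hy).
      replace (Cmult (F (circle 0 rho y)) (Cdiv (circle 0 rho y) (Cminus (circle 0 rho y) z)))
       with (Cmult (H (circle 0 rho y)) (circle 0 rho y)) by (unfold H; field; apply Hz1).
      replace (Cmult (F (circle 0 rho t)) (Cdiv (circle 0 rho t) (Cminus (circle 0 rho t) z)))
       with (Cmult (H (circle 0 rho t)) (circle 0 rho t)) by (unfold H; field; apply Hz1).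
      exact Q'. }
  assert (X0 : I0 = Cmult Ci J0).
  { unfold I0, J0. rewrite <- CInt_Cmult; try lra; auto.
    apply CInt_ext; try lra. intros t _. rewrite Hh0. unfold H, Phit.
    replace (e + 0 * (rho - e)) with e by ring.
    assert (Hc : Cmult e (cis t) <> 0).
    { apply Cmod_pos_neq0. rewrite Cmod_mult, Cmod_cis, Cmod_R, Rabs_pos_eq; lra. }
    replace (Cminus (circle z e t) z) with (Cmult e (cis t)) by (unfold circle; ring).
    replace (Cmult e (Cmult Ci (cis t))) with (Cmult Ci (Cmult e (cis t))) by ring.
    set (k := Cmult e (cis t)) in *. field. auto. }
  rewrite X1, X0 in E.
  replace J1 with (Cmult (Copp Ci) (Cmult Ci J1)).
  2:{ destruct J1; unfold Cmult, Copp, Ci; simpl; f_equal; ring. }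
  rewrite E. destruct J0; unfold Cmult, Copp, Ci; simpl; f_equal; ring.
Qed.

(** By the homotopy, [J] equals the integral of [F] over a circle around [z] of any small radius
    [e]; letting [e] shrink, continuity of [F] at [z] identifies the value. *)
Theorem cauchy_formula (F : C -> C) (rho : R) (z : C) :
  (forall w, Cmod w <= rho -> exists l, cdiff F w l) -> Cmod z < rho ->
  CInt (fun t => Cmult (F (circle 0 rho t)) (Cdiv (circle 0 rho t) (Cminus (circle 0 rho t) z)))
    0 (2 * PI) = Cmult (RtoC (2 * PI)) (F z).
Proof.
  intros HF Hz. assert (Hpi := PI_RGT_0). assert (Hz0 := Cmod_ge_0 z).
  set (J := CInt _ _ _).
  assert (K : forall eps, 0 < eps -> Cmod (Cminus J (Cmult (RtoC (2 * PI)) (F z))) <= eps).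
  { intros eps Heps. destruct (HF z) as [l Hl]; [lra|].
    (* [4 * PI] is twice the length of the interval of integration, the factor in [Cmod_CInt_le]. *)
    destruct (cdiff_cont F z l Hl (eps / (4 * PI))) as (d & Hd & Hc).
    { apply Rdiv_lt_0_compat; lra. }
    set (e := Rmin (d / 2) (rho - Cmod z)).
    assert (He : 0 < e) by (apply Rmin_pos; lra).
    assert (He1 : e <= d / 2) by apply Rmin_l.
    assert (He2 : e <= rho - Cmod z) by apply Rmin_r.
    unfold J; rewrite (cauchy_homotopy F rho e z) by (auto; lra).
    replace (Cmult (RtoC (2 * PI)) (F z)) with (CInt (fun _ => F z) 0 (2 * PI))
      by (rewrite CInt_const; do 2 f_equal; ring).
    assert (D0 : forall t, 0 <= t <= 2 * PI -> ccont (fun t => F (circle z e t)) t).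
    { intros t Ht. destruct (HF (circle z e t)) as [m Hm].
      { generalize (Cmod_minus_ge (circle z e t) z). rewrite Cmod_circle_minus; lra. }
      apply (ccont_comp F (circle z e)) with m; auto. apply ccont_circle. }
    rewrite <- CInt_minus; try lra; auto; try (intros; apply ccont_const).
    replace eps with (2 * (2 * PI - 0) * (eps / (4 * PI))) by (field; lra).
    apply Cmod_CInt_le; try lra.
    - intros; apply ccont_minus; auto; apply ccont_const.
    - intros t _. left; apply Hc. rewrite Cmod_circle_minus; lra. }
  assert (E : Cminus J (Cmult (RtoC (2 * PI)) (F z)) = 0).
  { apply Cmod_eq_0. apply Rle_antisym; [|apply Cmod_ge_0].
    apply le_epsilon. intros. rewrite Rplus_0_l. auto. }
  replace J with (Cplus (Cminus J (Cmult (RtoC (2 * PI)) (F z))) (Cmult (RtoC (2 * PI)) (F z))) by ring.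
  rewrite E; ring.
Qed.

(** * Local quadratic approximation *)

Lemma ccont_Cinv f x : ccont f x -> f x <> 0 -> ccont (fun t => Cinv (f t)) x.
Proof.
  intros Hf H0.
  destruct (cdiff_div_minus (fun _ => RtoC 1) (f x) 0 0) as [m Hm]; auto.
  { intros eps He; exists 1; split; [lra|]; intros w _.
    replace (Cminus (Cminus 1 1) (Cmult 0 (Cminus w (f x)))) with (RtoC 0) by ring.
    rewrite Cmod_0. apply Rmult_le_pos; [lra | apply Cmod_ge_0]. }
  assert (Q := ccont_comp _ f x m Hf Hm).
  revert Q; rewrite !ccont_eps. intros Q eps He; destruct (Q eps He) as (d & Hd & K).
  exists d; split; auto. intros y Hy; specialize (K y Hy).
  replace (Cinv (f y)) with (Cdiv 1 (Cminus (f y) 0)); [replace (Cinv (f x)) with (Cdiv 1 (Cminus (f x) 0))|]; auto;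
    unfold Cdiv; rewrite Cmult_1_l; f_equal; ring.
Qed.

Lemma ccont_bounded f a b : a <= b -> (forall x, a <= x <= b -> ccont f x) ->
  exists M, 0 <= M /\ forall x, a <= x <= b -> Cmod (f x) <= M.
Proof.
  intros Hab H. destruct (continuity_ab_maj (fun t => Cmod (f t)) a b Hab) as [x [Hx _]].
  - intros c Hc. apply continuity_pt_filterlim, ccont_Cmod_continuous; auto.
  - exists (Cmod (f x)); split; [apply Cmod_ge_0 | exact Hx].
Qed.

(** Every clause is a non-strict inequality between finitely many values of [F] and [F'], hence
    stable under pointwise limits of the pair; carrying [F'] as separate data is what allows
    this. *)
Definition quad_approx (z0 : C) (r M : R) (F F' : C -> C) : Prop :=
  forall z, Cmod (Cminus z z0) < r ->
    Cmod (F z) <= M /\ Cmod (F' z) <= M /\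
    forall w, Cmod (Cminus w z0) < r ->
      Cmod (Cminus (Cminus (F w) (F z)) (Cmult (F' z) (Cminus w z))) <= M * Cmod (Cminus w z) ^ 2.

Lemma quad_approx_cdiff z0 r M F F' z : quad_approx z0 r M F F' -> Cmod (Cminus z z0) < r ->
  cdiff F z (F' z).
Proof.
  intros HQ Hz eps Heps. destruct (HQ z Hz) as (H1 & _ & H2).
  assert (HM : 0 <= M) by (eapply Rle_trans; [apply Cmod_ge_0 | exact H1]).
  exists (Rmin (r - Cmod (Cminus z z0)) (eps / (M + 1))); split.
  - apply Rmin_pos; [lra | apply Rdiv_lt_0_compat; lra].
  - intros w Hw. assert (W1 := Rlt_le_trans _ _ _ Hw (Rmin_l _ _)).
    assert (W2 := Rlt_le_trans _ _ _ Hw (Rmin_r _ _)).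
    eapply Rle_trans; [apply H2|].
    + generalize (Cmod_triangle_minus w z z0); lra.
    + assert (Hp := Cmod_ge_0 (Cminus w z)).
      assert ((M + 1) * (eps / (M + 1)) = eps) by (field; lra).
      assert (M * Cmod (Cminus w z) <= eps) by nra. nra.
Qed.

Lemma quad_approx_weaken z0 z1 r r' M M' F F' : quad_approx z0 r M F F' ->
  r' + Cmod (Cminus z1 z0) <= r -> M <= M' -> quad_approx z1 r' M' F F'.
Proof.
  intros HQ Hr HM z Hz.
  assert (T : forall w, Cmod (Cminus w z1) < r' -> Cmod (Cminus w z0) < r).
  { intros w Hw. generalize (Cmod_triangle_minus w z1 z0); lra. }
  destruct (HQ z (T z Hz)) as (H1 & H2 & H3). repeat split; try lra.
  intros w Hw. eapply Rle_trans; [apply H3; auto|].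
  apply Rmult_le_compat_r; [apply pow2_ge_0 | auto].
Qed.

(** Cauchy's formula reads [F z = c * CInt (g * k z)], with [z] only in the kernel
    [k z = 1 / (ze - z)]. For [h = w - z] the identity [k w - k z - h (k z)^2 = h^2 (k w) (k z)^2]
    turns the remainder of [F] into an integral with the factor [h^2] visible. *)
Lemma cdiff_quad_approx_origin (F : C -> C) (rho : R) : 0 < rho ->
  (forall w, Cmod w <= rho -> exists l, cdiff F w l) ->
  exists M F', quad_approx 0 (rho / 2) M F F'.
Proof.
  intros Hr HF. assert (Hpi := PI_RGT_0).
  set (ze := circle 0 rho).
  assert (Hze : forall t, Cmod (ze t) = rho).
  { intros t. replace (ze t) with (Cminus (circle 0 rho t) 0) by (unfold ze; ring).
    apply Cmod_circle_minus; lra. }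
  assert (HcF : forall t, 0 <= t <= 2 * PI -> ccont (fun t => F (ze t)) t).
  { intros t _. destruct (HF (ze t)) as [l Hl]; [rewrite Hze; lra|].
    apply (ccont_comp F ze) with l; auto. apply ccont_circle. }
  destruct (ccont_bounded (fun t => F (ze t)) 0 (2 * PI)) as (B & HB0 & HB); [lra|auto|].
  pose (k := fun (z : C) (t : R) => Cinv (Cminus (ze t) z)).
  assert (Hd : forall z t, Cmod z < rho / 2 -> rho / 2 <= Cmod (Cminus (ze t) z)).
  { intros z t Hz. generalize (Cmod_minus_ge (ze t) z). rewrite Hze. lra. }
  assert (Hn : forall z t, Cmod z < rho / 2 -> Cminus (ze t) z <> 0).
  { intros z t Hz. apply Cmod_pos_neq0. generalize (Hd z t Hz); lra. }
  assert (Hk : forall z t, Cmod z < rho / 2 -> Cmod (k z t) <= 2 / rho).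
  { intros z t Hz. unfold k. rewrite Cmod_inv by (apply Hn; auto).
    replace (2 / rho) with (/ (rho / 2)) by (field; lra).
    apply Rinv_le_contravar; [lra | auto]. }
  assert (Hkc : forall z t, Cmod z < rho / 2 -> ccont (k z) t).
  { intros z t Hz. apply (ccont_Cinv (fun t => Cminus (ze t) z)); auto.
    apply ccont_minus; [apply ccont_circle | apply ccont_const]. }
  pose (g := fun t => Cmult (F (ze t)) (ze t)).
  assert (Hg : forall t, 0 <= t <= 2 * PI -> ccont g t).
  { intros; apply ccont_mult; auto; apply ccont_circle. }
  assert (HgB : forall t, 0 <= t <= 2 * PI -> Cmod (g t) <= B * rho).
  { intros t Ht. unfold g. rewrite Cmod_mult, Hze. apply Rmult_le_compat_r; [lra | auto]. }
  set (c := RtoC (/ (2 * PI))).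
  assert (Hc : Cmod c = / (2 * PI)).
  { unfold c. rewrite Cmod_R. apply Rabs_pos_eq. left; apply Rinv_0_lt_compat; lra. }
  assert (HI : forall f N, (forall t, 0 <= t <= 2 * PI -> ccont f t) ->
    (forall t, 0 <= t <= 2 * PI -> Cmod (f t) <= N) -> Cmod (Cmult c (CInt f 0 (2 * PI))) <= 2 * N).
  { intros f N Hf HN. rewrite Cmod_mult, Hc.
    apply Rmult_le_reg_l with (2 * PI); [lra|].
    rewrite <- Rmult_assoc, Rinv_r, Rmult_1_l by lra.
    eapply Rle_trans; [apply (Cmod_CInt_le f 0 (2 * PI) N); auto; lra|]. right; ring. }
  assert (HFz : forall z, Cmod z < rho / 2 ->
     F z = Cmult c (CInt (fun t => Cmult (g t) (k z t)) 0 (2 * PI))).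
  { intros z Hz.
    replace (CInt (fun t => Cmult (g t) (k z t)) 0 (2 * PI)) with (Cmult (RtoC (2 * PI)) (F z)).
    - rewrite Cmult_assoc. unfold c. rewrite <- RtoC_mult, Rinv_l by lra. ring.
    - rewrite <- (cauchy_formula F rho z); auto; [|lra].
      apply CInt_ext; [lra|]. intros t _. unfold g, k, Cdiv. fold ze. ring. }
  pose (F' := fun z => Cmult c (CInt (fun t => Cmult (Cmult (g t) (k z t)) (k z t)) 0 (2 * PI))).
  assert (H2r : 0 < 2 / rho) by (apply Rdiv_lt_0_compat; lra).
  set (q := 2 / rho) in *.
  assert (HBr : 0 <= B * rho) by nra.
  set (b := B * rho) in *.
  (* The summands bound [F], [F'] and the coefficient of the remainder, whose integrands contain
     one, two and three kernels, each at most [q] on the half disk. *)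
  exists (2 * (b * q) + 2 * (b * q * q) + 2 * (b * q * q * q)), F'.
  assert (P1 : 0 <= b * q) by nra. assert (P2 : 0 <= b * q * q) by nra.
  assert (P3 : 0 <= b * q * q * q) by nra.
  assert (mono : forall x y u v, Cmod x <= u -> Cmod y <= v -> Cmod (Cmult x y) <= u * v).
  { intros. rewrite Cmod_mult. apply Rmult_le_compat; auto using Cmod_ge_0. }
  assert (Z0 : forall z, Cminus z 0 = z) by (intros; ring).
  intros z Hz; rewrite Z0 in Hz. repeat split.
  - rewrite HFz by auto.
    eapply Rle_trans; [apply HI with (N := b * q)|lra].
    + intros; apply ccont_mult; auto.
    + intros; apply mono; auto.
  - unfold F'.
    eapply Rle_trans; [apply HI with (N := b * q * q)|lra].
    + intros; apply ccont_mult; auto; apply ccont_mult; auto.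
    + intros; apply mono; auto.
  - intros w Hw; rewrite Z0 in Hw.
    set (h := Cminus w z).
    assert (E : Cminus (Cminus (F w) (F z)) (Cmult (F' z) h) =
      Cmult c (CInt (fun t => Cmult (Cmult (Cmult (Cmult (g t) (k w t)) (k z t)) (k z t)) (Cmult h h)) 0 (2 * PI))).
    { rewrite (HFz w), (HFz z) by auto. unfold F'.
      assert (C1 : forall v t, Cmod v < rho / 2 -> 0 <= t <= 2 * PI -> ccont (fun t => Cmult (g t) (k v t)) t)
        by (intros; apply ccont_mult; auto).
      assert (C2 : forall t, 0 <= t <= 2 * PI ->
        ccont (fun t => Cmult (Cmult (g t) (k z t)) (k z t)) t) by (intros; apply ccont_mult; auto).
      rewrite (CInt_ext (fun t => Cmult (Cmult (Cmult (Cmult (g t) (k w t)) (k z t)) (k z t)) (Cmult h h))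
        (fun t => Cminus (Cminus (Cmult (g t) (k w t)) (Cmult (g t) (k z t)))
         (Cmult h (Cmult (Cmult (g t) (k z t)) (k z t)))) 0 (2 * PI)).
      - rewrite CInt_minus, CInt_minus, CInt_Cmult; try lra; auto.
        + ring.
        + intros; apply ccont_minus; auto.
        + intros; apply ccont_mult; auto; apply ccont_const.
      - lra.
      - intros t _. unfold k, h. field. split; apply Hn; auto. }
    rewrite E.
    eapply Rle_trans; [apply HI with (N := b * q * q * q * (Cmod h * Cmod h))|].
    + intros; apply ccont_mult; [|apply ccont_const]. do 3 (apply ccont_mult; [|auto]); auto.
    + intros. apply mono; [do 3 (apply mono; [|auto]); auto | rewrite Cmod_mult; lra].
    + assert (0 <= Cmod h * Cmod h) by (generalize (Cmod_ge_0 h); nra).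
      replace (Cmod h ^ 2) with (Cmod h * Cmod h) by ring.
      apply Rle_trans with (2 * (b * q * q * q) * (Cmod h * Cmod h)); [right; ring|].
      apply Rmult_le_compat_r; lra.
Qed.

(** One halving of the radius passes to a closed disk on which [F] is differentiable, the other
    keeps [z] away from the circle of integration. *)
Theorem cdiff_quad_approx (F : C -> C) (z0 : C) (r : R) : 0 < r ->
  (forall w, Cmod (Cminus w z0) < r -> exists l, cdiff F w l) ->
  exists M F', quad_approx z0 (r / 4) M F F'.
Proof.
  intros Hr HF.
  destruct (cdiff_quad_approx_origin (fun w => F (Cplus z0 w)) (r / 2)) as (M & F' & HQ); [lra|..].
  - intros w Hw. destruct (HF (Cplus z0 w)) as [l Hl].
    { replace (Cminus (Cplus z0 w) z0) with w by ring. lra. }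
    exists l. intros eps He. destruct (Hl eps He) as (d & Hd & K). exists d; split; auto.
    intros v Hv. specialize (K (Cplus z0 v)).
    replace (Cminus (Cplus z0 v) (Cplus z0 w)) with (Cminus v w) in K by ring. auto.
  - exists M, (fun z => F' (Cminus z z0)).
    assert (E : forall z, Cplus z0 (Cminus z z0) = z) by (intros; ring).
    assert (E0 : forall z, Cminus (Cminus z z0) 0 = Cminus z z0) by (intros; ring).
    intros z Hz. destruct (HQ (Cminus z z0)) as (H1 & H2 & H3); [rewrite E0; lra|].
    rewrite E in H1, H3. repeat split; auto.
    intros w Hw. specialize (H3 (Cminus w z0)). rewrite E, E0 in H3.
    replace (Cminus (Cminus w z0) (Cminus z z0)) with (Cminus w z) in H3 by ring.
    apply H3; lra.
Qed.

(** * Compactness via ultralimits *)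

Record free_ultrafilter (U : (nat -> Prop) -> Prop) : Prop := {
  uf_mono : forall A B : nat -> Prop, (forall n, A n -> B n) -> U A -> U B;
  uf_and : forall A B, U A -> U B -> U (fun n => A n /\ B n);
  uf_ex : forall A, U A -> exists n, A n;
  uf_or : forall A, U A \/ U (fun n => ~ A n);
  uf_free : forall N, U (fun n => (N <= n)%nat) }.

(** An ultrafilter refining the filter of tails; the refinement is what yields [uf_free]. *)
Lemma free_ultrafilter_exists : exists U, free_ultrafilter U.
Proof.
  destruct (@filter.ultraFilterLemma nat filter.eventually filter.eventually_filter)
    as [U [HU Hsub]].
  assert (PU := @filter.ultra_proper _ _ HU).
  assert (FU := @filter.filter_filter _ _ PU).
  exists U; split.
  - intros A B HAB. apply (@filter.filterS _ _ FU A B HAB).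
  - intros A B HA HB. apply (@filter.filterI _ _ FU A B HA HB).
  - intros A HA. apply (@filter.filter_ex _ _ PU A HA).
  - intros A. apply (@filter.in_ultra_setVsetC _ _ A HU).
  - intros N. apply Hsub. exists N; [exact I|]. intros n Hn. exact (ssrbool.elimT ssrnat.leP Hn).
Qed.

Definition ulim (U : (nat -> Prop) -> Prop) (a : nat -> C) (l : C) : Prop :=
  forall eps, 0 < eps -> U (fun n => Cmod (Cminus (a n) l) < eps).

Section Ultralimits.

Variable U : (nat -> Prop) -> Prop.
Hypothesis HU : free_ultrafilter U.

Lemma uf_all (A : nat -> Prop) : (forall n, A n) -> U A.
Proof. intros H. apply (uf_mono U HU (fun n => (0 <= n)%nat)); auto. apply (uf_free U HU). Qed.

Lemma real_ultralimit (a : nat -> R) (M : R) : (forall n, Rabs (a n) <= M) ->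
  exists l, forall eps, 0 < eps -> U (fun n => Rabs (a n - l) < eps).
Proof.
  intros HM.
  assert (HM' : forall n, - M <= a n <= M) by (intros n; apply Rabs_le_between, HM).
  (* The ultralimit is the supremum of the numbers that lie below [a n] for [U]-almost all [n];
     [uf_or] turns a failure of such a bound into its negation holding almost everywhere. *)
  destruct (completeness (fun x => U (fun n => x <= a n))) as [l [Hl1 Hl2]].
  - exists M; intros x Hx. destruct (uf_ex U HU _ Hx) as [n Hn]. specialize (HM' n); lra.
  - exists (- M). apply uf_all. intros n; apply HM'.
  - exists l; intros eps He.
    assert (A1 : U (fun n => l - eps / 2 <= a n)).
    { destruct (uf_or U HU (fun n => l - eps / 2 <= a n)) as [h|h]; auto.
      exfalso. assert (l <= l - eps / 2); [|lra].
      apply Hl2. intros x Hx. apply Rnot_lt_le; intros Hlt.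
      destruct (uf_ex U HU _ (uf_and U HU _ _ Hx h)) as [n [Hn1 Hn2]]. apply Hn2; lra. }
    assert (A2 : U (fun n => ~ l + eps / 2 <= a n)).
    { destruct (uf_or U HU (fun n => l + eps / 2 <= a n)) as [h|h]; auto.
      specialize (Hl1 _ h). lra. }
    apply (uf_mono U HU) with (2 := uf_and U HU _ _ A1 A2).
    intros n [h1 h2]. apply Rabs_def1; lra.
Qed.

Lemma ulim_exists (a : nat -> C) (M : R) : (forall n, Cmod (a n) <= M) -> exists l, ulim U a l.
Proof.
  intros HM.
  destruct (real_ultralimit (fun n => fst (a n)) M) as [x Hx].
  { intros n; eapply Rle_trans; [apply Rabs_fst_le_Cmod | apply HM]. }
  destruct (real_ultralimit (fun n => snd (a n)) M) as [y Hy].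
  { intros n; eapply Rle_trans; [apply Rabs_snd_le_Cmod | apply HM]. }
  exists (x, y); intros eps He.
  apply (uf_mono U HU) with
    (2 := uf_and U HU _ _ (Hx (eps / 2) ltac:(lra)) (Hy (eps / 2) ltac:(lra))).
  intros n [h1 h2]. eapply Rle_lt_trans; [apply Cmod_le_Rabs|].
  simpl. unfold Rminus in *; lra.
Qed.

Lemma ulim_minus a b l m : ulim U a l -> ulim U b m ->
  ulim U (fun n => Cminus (a n) (b n)) (Cminus l m).
Proof.
  intros Ha Hb eps He.
  apply (uf_mono U HU) with
    (2 := uf_and U HU _ _ (Ha (eps / 2) ltac:(lra)) (Hb (eps / 2) ltac:(lra))).
  intros n [h1 h2].
  replace (Cminus (Cminus (a n) (b n)) (Cminus l m)) with
    (Cplus (Cminus (a n) l) (Copp (Cminus (b n) m))) by ring.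
  eapply Rle_lt_trans; [apply Cmod_triangle|]. rewrite Cmod_opp; lra.
Qed.

Lemma ulim_Cmult_r a l c : ulim U a l -> ulim U (fun n => Cmult (a n) c) (Cmult l c).
Proof.
  intros Ha eps He. assert (Hc := Cmod_ge_0 c).
  assert (He' : 0 < eps / (Cmod c + 1)) by (apply Rdiv_lt_0_compat; lra).
  apply (uf_mono U HU) with (2 := Ha _ He').
  intros n Hn. replace (Cminus (Cmult (a n) c) (Cmult l c)) with (Cmult (Cminus (a n) l) c) by ring.
  rewrite Cmod_mult. assert (Hp := Cmod_ge_0 (Cminus (a n) l)).
  replace eps with (eps / (Cmod c + 1) * (Cmod c + 1)) by (field; lra). nra.
Qed.

Lemma ulim_Cmod_le a l M : (forall n, Cmod (a n) <= M) -> ulim U a l -> Cmod l <= M.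
Proof.
  intros HM Ha. apply le_epsilon. intros eps He.
  destruct (uf_ex U HU _ (Ha eps He)) as [n Hn].
  generalize (Cmod_minus_ge l (a n)). rewrite Cmod_minus_sym. specialize (HM n); lra.
Qed.

Lemma ulim_unique a l m : ulim U a l -> ulim U a m -> l = m.
Proof.
  intros H1 H2.
  assert (H0 : Cmod (Cminus l m) <= 0).
  { apply le_epsilon. intros eps He.
    destruct (uf_ex U HU _ (uf_and U HU _ _ (H1 (eps / 2) ltac:(lra)) (H2 (eps / 2) ltac:(lra))))
      as [n [h1 h2]].
    generalize (Cmod_triangle_minus l (a n) m). rewrite (Cmod_minus_sym l (a n)). lra. }
  assert (E : Cminus l m = 0) by (apply Cmod_eq_0, Rle_antisym; auto using Cmod_ge_0).
  replace l with (Cplus (Cminus l m) m) by ring. rewrite E; ring.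
Qed.

End Ultralimits.

(* A Montel-type compactness statement; pointwise ultralimits replace the extraction of
   convergent subsequences. *)
Lemma quad_approx_ultralimit U z0 r M (F F' : nat -> C -> C) : free_ultrafilter U ->
  (forall n, quad_approx z0 r M (F n) (F' n)) ->
  exists G G', quad_approx z0 r M G G' /\ forall z, Cmod (Cminus z z0) < r -> ulim U (fun n => F n z) (G z).
Proof.
  intros HU HQ.
  (* The condition stands inside the existential so that choice gives a total function; off the disk
     the value is the dummy 0. *)
  assert (HG : forall z, exists l, Cmod (Cminus z z0) < r -> ulim U (fun n => F n z) l).
  { intros z; destruct (Rlt_dec (Cmod (Cminus z z0)) r) as [h|h].
    - destruct (ulim_exists U HU (fun n => F n z) M) as [l Hl]; [intros n; apply (HQ n z h)|].
      exists l; auto.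
    - exists (RtoC 0); contradiction. }
  assert (HG' : forall z, exists l, Cmod (Cminus z z0) < r -> ulim U (fun n => F' n z) l).
  { intros z; destruct (Rlt_dec (Cmod (Cminus z z0)) r) as [h|h].
    - destruct (ulim_exists U HU (fun n => F' n z) M) as [l Hl]; [intros n; apply (HQ n z h)|].
      exists l; auto.
    - exists (RtoC 0); contradiction. }
  exists (fun z => proj1_sig (constructive_indefinite_description _ (HG z))),
    (fun z => proj1_sig (constructive_indefinite_description _ (HG' z))).
  split; [|intros z Hz; apply (proj2_sig (constructive_indefinite_description _ (HG z)) Hz)].
  intros z Hz.
  assert (K := fun w => proj2_sig (constructive_indefinite_description _ (HG w))).
  assert (K' := proj2_sig (constructive_indefinite_description _ (HG' z)) Hz).
  cbv beta in K, K'. repeat split.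
  - apply (ulim_Cmod_le U HU (fun n => F n z)); [intros n; apply (HQ n z Hz) | apply K, Hz].
  - apply (ulim_Cmod_le U HU (fun n => F' n z)); [intros n; apply (HQ n z Hz) | apply K'].
  - intros w Hw.
    apply (ulim_Cmod_le U HU (fun n =>
      Cminus (Cminus (F n w) (F n z)) (Cmult (F' n z) (Cminus w z)))).
    + intros n; apply (HQ n z Hz); auto.
    + apply ulim_minus; auto; [apply ulim_minus; auto | apply ulim_Cmult_r; auto].
Qed.

(** * A function that is Lipschitz at no point of a dense sequence *)

(** Cantor's argument: of the two outer closed thirds of an interval at least one misses the next
    [s n]. Starting from the middle third of [[a, b]] keeps the limit strictly inside. *)
Lemma interval_avoids_sequence (s : nat -> R) (a b : R) : a < b ->
  exists t, a < t < b /\ forall n, t <> s n.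
Proof.
  intros Hab.
  pose (next := fun (p : R * R) (x : R) =>
    if Rlt_dec x ((fst p + 2 * snd p) / 3) then ((fst p + 2 * snd p) / 3, snd p)
    else (fst p, (2 * fst p + snd p) / 3)).
  pose (P := fix P n := match n with O => ((2 * a + b) / 3, (a + 2 * b) / 3)
                               | S n => next (P n) (s n) end).
  assert (Hlt : forall n, fst (P n) < snd (P n)).
  { induction n as [|n IH]; simpl; [lra|]. unfold next; destruct Rlt_dec; simpl; lra. }
  destruct (nested_intervals (fun n => fst (P n)) (fun n => snd (P n))) as [t Ht].
  - intros n; generalize (Hlt n); simpl. unfold next; destruct Rlt_dec; simpl; lra.
  - intros n; generalize (Hlt n); simpl. unfold next; destruct Rlt_dec; simpl; lra.
  - intros n; left; apply Hlt.
  - exists t; split; [generalize (Ht O); simpl; lra|].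
    intros n E. generalize (Ht (S n)) (Hlt n); simpl; unfold next; destruct Rlt_dec; simpl; lra.
Qed.

(** * Norm, distance and derivative of the statement in terms of [Cmod] and [cdiff] *)

Lemma Cnorm_Cmod (z : C) : Cnorm z = Cmod z.
Proof. unfold Cnorm, Cmod. f_equal. ring. Qed.

Lemma Cdist_Cmod (z w : C) : Cdist z w = Cmod (Cminus z w).
Proof. apply Cnorm_Cmod. Qed.

Lemma C_differentiable_at_cdiff (F : C -> C) (z : C) : C_differentiable_at F z <-> exists l, cdiff F z l.
Proof.
  split; intros [l H]; exists l; intros eps He; destruct (H eps He) as (d & Hd & K);
    exists d; split; auto.
  - intros w Hw. specialize (K (Cminus w z)).
    rewrite !Cnorm_Cmod in K.
    replace (Cadd z (Cminus w z)) with w in K; [exact (K Hw)|].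
    change (@eq C w (Cplus z (Cminus w z))); ring.
  - intros h Hh. rewrite Cnorm_Cmod in *. specialize (K (Cplus z h)).
    assert (E : Cminus (Cplus z h) z = h :> C) by ring. rewrite E in K. rewrite Cnorm_Cmod. exact (K Hh).
Qed.

(** The integer [up x] is split into positive and negative parts, because the grid of rational
    centres is to be enumerated by naturals. *)
Lemma nat_difference_near (x : R) : exists i j : nat, Rabs (INR i - INR j - x) <= 1.
Proof.
  exists (Z.to_nat (up x)), (Z.to_nat (- up x)).
  replace (INR (Z.to_nat (up x)) - INR (Z.to_nat (- up x))) with (IZR (up x)).
  - destruct (archimed x). apply Rabs_le; lra.
  - rewrite !INR_IZR_INZ, <- minus_IZR. f_equal. lia.
Qed.

Lemma inv_INR_S_small (d : R) : 0 < d -> exists n, / (INR n + 1) < d.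
Proof.
  intros Hd. destruct (archimed_cor1 d Hd) as (n & Hn & Hp). exists n.
  eapply Rle_lt_trans; [|exact Hn].
  apply Rinv_le_contravar; [apply lt_0_INR; auto | lra].
Qed.

(** [L] may contain no rational point, so a point of [L] is chosen in every disk of a countable
    family that meets [L], and [z0] is the default for the others. The radius is twice the mesh
    [1 / (k + 1)], since each coordinate of the nearest centre may be off by one mesh. *)
Lemma dense_sequence_exists (L : C -> Prop) : (exists z, L z) ->
  exists zs : nat -> C, (forall n, L (zs n)) /\
    forall z eps, L z -> 0 < eps -> exists n, Cmod (Cminus (zs n) z) < eps.
Proof.
  intros [z0 Hz0].
  pose (center := fun n =>
    let (p, k) := Cantor.of_nat n in let (p1, p2) := Cantor.of_nat p in
    let (i, i') := Cantor.of_nat p1 in let (j, j') := Cantor.of_nat p2 in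
    (((INR i - INR i') / (INR k + 1), (INR j - INR j') / (INR k + 1)) : C)).
  pose (rad := fun n => 2 / (INR (snd (Cantor.of_nat n)) + 1)).
  pose (Q := fun n w => L w /\ Cmod (Cminus w (center n)) <= rad n).
  pose (zs := fun n => match excluded_middle_informative (exists w, Q n w) with
    | left h => proj1_sig (constructive_indefinite_description _ h) | right _ => z0 end).
  assert (Hzs : forall n, (exists w, Q n w) -> Q n (zs n)).
  { intros n h. unfold zs. destruct excluded_middle_informative as [h'|]; [|contradiction].
    apply (proj2_sig (constructive_indefinite_description _ h')). }
  exists zs; split.
  - intros n. destruct (classic (exists w, Q n w)) as [h|h]; [apply (Hzs n h)|].
    unfold zs. destruct excluded_middle_informative; [contradiction | auto].
  - intros z eps Hz He.
    (* Two points of one disk are at distance at most [2 * rad n = 4 / (INR k + 1)]. *)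
    destruct (inv_INR_S_small (eps / 4)) as [k Hk]; [lra|].
    assert (HK : 0 < INR k + 1) by (generalize (pos_INR k); lra).
    destruct (nat_difference_near (fst z * (INR k + 1))) as (i & i' & Hi).
    destruct (nat_difference_near (snd z * (INR k + 1))) as (j & j' & Hj).
    set (n := Cantor.to_nat (Cantor.to_nat (Cantor.to_nat (i, i'), Cantor.to_nat (j, j')), k)).
    exists n.
    assert (Hc : center n = ((INR i - INR i') / (INR k + 1), (INR j - INR j') / (INR k + 1))).
    { unfold center, n. now rewrite !Cantor.cancel_of_to. }
    assert (Hr : rad n = 2 / (INR k + 1)) by (unfold rad, n; now rewrite Cantor.cancel_of_to).
    assert (D : forall x m, Rabs (m - x * (INR k + 1)) <= 1 -> Rabs (x + - (m / (INR k + 1))) <= / (INR k + 1)).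
    { intros x m H.
      replace (x + - (m / (INR k + 1))) with (- ((m - x * (INR k + 1)) * / (INR k + 1))) by (field; lra).
      rewrite Rabs_Ropp, Rabs_mult, (Rabs_pos_eq (/ _)) by (left; apply Rinv_0_lt_compat; auto).
      rewrite <- (Rmult_1_l (/ (INR k + 1))) at 2.
      apply Rmult_le_compat_r; [left; apply Rinv_0_lt_compat|]; auto. }
    assert (Hq : Cmod (Cminus z (center n)) <= rad n).
    { eapply Rle_trans; [apply Cmod_le_Rabs|]. rewrite Hc, Hr. simpl.
      generalize (D _ _ Hi) (D _ _ Hj). unfold Rdiv; lra. }
    destruct (Hzs n) as [_ Hd]; [exists z; split; auto|].
    generalize (Cmod_triangle_minus (zs n) (center n) z).
    rewrite (Cmod_minus_sym (center n)). rewrite Hr in *. unfold Rdiv in *. lra.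
Qed.

(** * The square-root cusp and its series *)

Lemma sqrt_sub_le x y : 0 <= x -> 0 <= y -> sqrt x - sqrt y <= sqrt (Rabs (x - y)).
Proof.
  intros Hx Hy. destruct (Rle_dec x y) as [h|h].
  - generalize (sqrt_le_1 x y Hx Hy h) (sqrt_pos (Rabs (x - y))); lra.
  - rewrite Rabs_pos_eq by lra.
    apply Rle_minus_l. apply Rsqr_incr_0_var; [|generalize (sqrt_pos (x - y)) (sqrt_pos y); lra].
    unfold Rsqr. generalize (sqrt_sqrt x Hx) (sqrt_sqrt y Hy) (sqrt_sqrt (x - y) ltac:(lra))
      (sqrt_pos (x - y)) (sqrt_pos y). nra.
Qed.

Definition cusp (a z : C) : R := Rmin 1 (sqrt (Cmod (Cminus z a))).

Lemma cusp_bounds a z : 0 <= cusp a z <= 1.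
Proof. unfold cusp; split; [apply Rmin_glb; [lra | apply sqrt_pos] | apply Rmin_l]. Qed.

Lemma Rmin_1_sub x y e : 0 <= e -> x - y <= e -> Rmin 1 x - Rmin 1 y <= e.
Proof. intros. unfold Rmin; destruct (Rle_dec 1 x), (Rle_dec 1 y); lra. Qed.

Lemma cusp_holder a z w : Rabs (cusp a w - cusp a z) <= sqrt (Cmod (Cminus w z)).
Proof.
  assert (H : forall z w, cusp a w - cusp a z <= sqrt (Cmod (Cminus w z))).
  { intros z' w'. apply Rmin_1_sub; [apply sqrt_pos|].
    eapply Rle_trans; [apply sqrt_sub_le; apply Cmod_ge_0|].
    apply sqrt_le_1; [apply Rabs_pos | apply Cmod_ge_0|].
    apply Rabs_le.
    generalize (Cmod_triangle_minus w' z' a) (Cmod_triangle_minus z' w' a).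
    rewrite (Cmod_minus_sym z' w'). lra. }
  apply Rabs_le. generalize (H z w) (H w z). rewrite (Cmod_minus_sym z w). lra.
Qed.

(** At [z = a] the cusp has its minimum, so [K = 0] works; elsewhere
    [sqrt x - sqrt y <= (x - y) / sqrt x] for [y <= x]. The lower bound is the one that holds at
    every [z], and [z = a] does matter: the dense sequence may repeat points, so an earlier cusp may
    sit at [zs k] as well. *)
Lemma cusp_one_sided_lipschitz a z : exists K, forall w,
  - K * Cmod (Cminus w z) <= cusp a w - cusp a z.
Proof.
  destruct (classic (z = a)) as [->|Hza].
  - exists 0; intros w. replace (cusp a a) with 0.
    + generalize (cusp_bounds a w); lra.
    + unfold cusp. replace (Cminus a a) with (RtoC 0) by ring.
      rewrite Cmod_0, sqrt_0, Rmin_right; lra.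
  - assert (Hs : 0 < Cmod (Cminus z a)).
    { apply Cmod_gt_0. intros E. apply Hza.
      replace z with (Cplus (Cminus z a) a) by ring. rewrite E; ring. }
    assert (Hq := sqrt_lt_R0 _ Hs).
    exists (/ sqrt (Cmod (Cminus z a))). intros w.
    assert (HK := Rinv_0_lt_compat _ Hq).
    set (x := Cmod (Cminus z a)) in *. set (K := / sqrt x) in *.
    assert (Hd := Cmod_ge_0 (Cminus w z)).
    enough (cusp a z - cusp a w <= K * Cmod (Cminus w z)) by lra.
    apply Rmin_1_sub; [nra|]. fold x.
    assert (Hy0 := Cmod_ge_0 (Cminus w a)).
    assert (Hxy : x - Cmod (Cminus w a) <= Cmod (Cminus w z)).
    { unfold x. generalize (Cmod_triangle_minus z w a). rewrite (Cmod_minus_sym z w). lra. }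
    set (y := Cmod (Cminus w a)) in *. set (t := Cmod (Cminus w z)) in *.
    assert (HKx : K * sqrt x = 1) by (unfold K; field; lra).
    assert (Sx := sqrt_sqrt x (Rlt_le _ _ Hs)). assert (Sy := sqrt_sqrt y Hy0).
    assert (Py := sqrt_pos y).
    apply Rmult_le_reg_l with (1 := Hq).
    replace (sqrt x * (K * t)) with t by (rewrite <- Rmult_assoc, (Rmult_comm (sqrt x)), HKx; ring).
    destruct (Rle_dec (sqrt x) (sqrt y)); nra.
Qed.

Section CuspSeries.

Variable zs : nat -> C.

Definition cusp_term (z : C) (n : nat) : R := (/ 4) ^ n * cusp (zs n) z.

Definition cusp_series (z : C) : R := Series (cusp_term z).

Lemma ex_series_geom_quarter c : ex_series (fun n => (/ 4) ^ n * c).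
Proof. apply ex_series_scal_r, ex_series_geom. rewrite Rabs_pos_eq; lra. Qed.

Lemma Series_geom_quarter c : Series (fun n => (/ 4) ^ n * c) = 4 / 3 * c.
Proof. rewrite Series_scal_r, Series_geom by (rewrite Rabs_pos_eq; lra). field. Qed.

Lemma Rabs_Series_quarter_le (a : nat -> R) c : (forall n, Rabs (a n) <= (/ 4) ^ n * c) ->
  ex_series a /\ Rabs (Series a) <= 4 / 3 * c.
Proof.
  intros H.
  assert (E : ex_series (fun n => Rabs (a n))).
  { apply (ex_series_le (K := R_AbsRing) (V := R_CompleteNormedModule)) with (2 := ex_series_geom_quarter c).
    intros n. unfold norm; simpl. unfold abs; simpl. rewrite Rabs_Rabsolu. apply H. }
  split; [apply ex_series_Rabs, E|].
  eapply Rle_trans; [apply Series_Rabs, E|].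
  rewrite <- Series_geom_quarter. apply Series_le; [|apply ex_series_geom_quarter].
  intros n; split; [apply Rabs_pos | apply H].
Qed.

Lemma pow_quarter_pos n : 0 < (/ 4) ^ n.
Proof. apply pow_lt; lra. Qed.

Lemma cusp_term_sum z : ex_series (cusp_term z) /\ Rabs (cusp_series z) <= 4 / 3 * 1.
Proof.
  apply Rabs_Series_quarter_le. intros n. unfold cusp_term.
  generalize (pow_quarter_pos n) (cusp_bounds (zs n) z); intros.
  rewrite Rabs_pos_eq by nra. nra.
Qed.

Lemma cusp_term_holder z w n :
  Rabs (cusp_term w n - cusp_term z n) <= (/ 4) ^ n * sqrt (Cmod (Cminus w z)).
Proof.
  unfold cusp_term. rewrite <- Rmult_minus_distr_l, Rabs_mult.
  generalize (pow_quarter_pos n); intros.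
  rewrite (Rabs_pos_eq (_ ^ _)) by lra. apply Rmult_le_compat_l; [lra | apply cusp_holder].
Qed.

Lemma cusp_series_minus z w :
  cusp_series w - cusp_series z = Series (fun n => cusp_term w n - cusp_term z n).
Proof. symmetry. apply Series_minus; apply cusp_term_sum. Qed.

Lemma cusp_series_holder z w :
  Rabs (cusp_series w - cusp_series z) <= 4 / 3 * sqrt (Cmod (Cminus w z)).
Proof.
  rewrite cusp_series_minus. apply Rabs_Series_quarter_le. apply cusp_term_holder.
Qed.

Lemma cusp_partial_sum_lower z k : exists K, forall w,
  - K * Cmod (Cminus w z) <= sum_f_R0 (fun n => cusp_term w n - cusp_term z n) k.
Proof.
  assert (T : forall n, exists K, forall w,
    - K * Cmod (Cminus w z) <= cusp_term w n - cusp_term z n).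
  { intros n. destruct (cusp_one_sided_lipschitz (zs n) z) as [K HK].
    exists ((/ 4) ^ n * K). intros w. unfold cusp_term. specialize (HK w).
    generalize (pow_quarter_pos n). nra. }
  induction k as [|k [K IH]]; simpl; [apply T|].
  destruct (T (S k)) as [K' HK']. exists (K + K'). intros w.
  generalize (IH w) (HK' w). lra.
Qed.

Lemma cusp_partial_sum_lower_at k : exists K, forall w, Cmod (Cminus w (zs k)) <= 1 ->
  (/ 4) ^ k * sqrt (Cmod (Cminus w (zs k))) - K * Cmod (Cminus w (zs k)) <=
  sum_f_R0 (fun n => cusp_term w n - cusp_term (zs k) n) k.
Proof.
  (* Within distance 1 the truncation in [cusp] is inactive. *)
  assert (T : forall w, Cmod (Cminus w (zs k)) <= 1 ->
    cusp_term w k - cusp_term (zs k) k = (/ 4) ^ k * sqrt (Cmod (Cminus w (zs k)))).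
  { intros w Hw. unfold cusp_term, cusp.
    replace (Cminus (zs k) (zs k)) with (RtoC 0) by ring.
    rewrite Cmod_0, sqrt_0, (Rmin_right 1 0) by lra.
    rewrite Rmin_right; [ring|]. rewrite <- sqrt_1. apply sqrt_le_1; auto using Cmod_ge_0; lra. }
  destruct k as [|k].
  - exists 0. intros w Hw. simpl sum_f_R0. rewrite T by auto. lra.
  - destruct (cusp_partial_sum_lower (zs (S k)) k) as [K HK]. exists K. intros w Hw.
    rewrite tech5, T by auto. generalize (HK w). lra.
Qed.

(* At [zs k] the cusp of index [k] has size [4^-k sqrt|w - zs k|], the later ones together at most
   a third of this, and the earlier ones are one-sidedly Lipschitz. *)
Lemma cusp_series_lower k : exists K, forall w, Cmod (Cminus w (zs k)) <= 1 ->
  2 / 3 * (/ 4) ^ k * sqrt (Cmod (Cminus w (zs k))) - K * Cmod (Cminus w (zs k)) <=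
  cusp_series w - cusp_series (zs k).
Proof.
  destruct (cusp_partial_sum_lower_at k) as [K HK]. exists K. intros w Hw.
  specialize (HK w Hw). rewrite cusp_series_minus.
  set (a := fun n => cusp_term w n - cusp_term (zs k) n) in *.
  assert (Ha := cusp_term_holder (zs k) w).
  rewrite (Series_incr_n a (S k)); [|lia|apply (Rabs_Series_quarter_le a _ Ha)].
  simpl pred.
  destruct (Rabs_Series_quarter_le (fun j => a (S k + j)%nat)
     ((/ 4) ^ S k * sqrt (Cmod (Cminus w (zs k))))) as [_ Ht].
  { intros n. eapply Rle_trans; [apply Ha|]. rewrite pow_add. right; ring. }
  apply Rabs_le_between in Ht. rewrite <- tech_pow_Rmult in Ht. lra.
Qed.

End CuspSeries.

(** Only increments from [p] itself are compared, so differentiability of an extension at the single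
    point [p] already gives the property. *)
Definition lipschitz_at (L : C -> Prop) (p : C) (u : C -> C) : Prop :=
  exists K d, 0 < d /\ forall w, L w -> Cmod (Cminus w p) < d ->
    Cmod (Cminus (u w) (u p)) <= K * Cmod (Cminus w p).

Lemma cdiff_lipschitz_at L p F l : cdiff F p l -> lipschitz_at L p F.
Proof.
  intros H. destruct (H 1 Rlt_0_1) as (d & Hd & K). exists (1 + Cmod l), d; split; auto.
  intros w _ Hw. specialize (K w Hw).
  replace (Cminus (F w) (F p)) with
    (Cplus (Cminus (Cminus (F w) (F p)) (Cmult l (Cminus w p))) (Cmult l (Cminus w p))) by ring.
  eapply Rle_trans; [apply Cmod_triangle|]. rewrite Cmod_mult. lra.
Qed.

Lemma cusp_series_not_lipschitz_at L zs k :
  (forall eps, 0 < eps -> exists w, L w /\ w <> zs k /\ Cmod (Cminus w (zs k)) < eps) ->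
  ~ lipschitz_at L (zs k) (fun z => RtoC (cusp_series zs z)).
Proof.
  intros Hiso (M & d & Hd & HM).
  destruct (cusp_series_lower zs k) as [K HK].
  assert (Hp := pow_quarter_pos k).
  set (N := Rabs M + Rabs K + 1).
  assert (HN : 0 < N) by (unfold N; generalize (Rabs_pos M) (Rabs_pos K); lra).
  (* With [t = Cmod (w - zs k)], the two bounds combine to [N * s * sqrt t <= N * t], that is
     [s <= sqrt t], which fails once [t < s * s]. *)
  set (s := 2 / 3 * (/ 4) ^ k / N).
  assert (Hs : 0 < s) by (apply Rdiv_lt_0_compat; lra).
  destruct (Hiso (Rmin d (Rmin 1 (s * s)))) as (w & Lw & Hne & Hw).
  { repeat apply Rmin_pos; nra. }
  assert (W1 := Rlt_le_trans _ _ _ Hw (Rmin_l _ _)).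
  assert (W := Rlt_le_trans _ _ _ Hw (Rmin_r _ _)).
  assert (W2 := Rlt_le_trans _ _ _ W (Rmin_l _ _)).
  assert (W3 := Rlt_le_trans _ _ _ W (Rmin_r _ _)).
  specialize (HM w Lw W1). specialize (HK w (Rlt_le _ _ W2)).
  rewrite <- RtoC_minus, Cmod_R in HM.
  assert (Ht : 0 < Cmod (Cminus w (zs k))).
  { apply Cmod_gt_0. intros E. apply Hne.
    replace w with (Cplus (Cminus w (zs k)) (zs k)) by ring. rewrite E; ring. }
  set (t := Cmod (Cminus w (zs k))) in *.
  assert (Hq := sqrt_lt_R0 t Ht). assert (Sq := sqrt_sqrt t (Rlt_le _ _ Ht)).
  assert (Hsq : sqrt t < s) by (rewrite <- (sqrt_square s) by lra; apply sqrt_lt_1; nra).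
  assert (HsN : N * s = 2 / 3 * (/ 4) ^ k) by (unfold s; field; lra).
  apply Rabs_le_between in HM.
  assert (2 / 3 * (/ 4) ^ k * sqrt t <= N * t).
  { unfold N. generalize (Rle_abs M) (Rle_abs K). nra. }
  assert (N * s * sqrt t <= N * sqrt t * sqrt t) by (rewrite HsN; nra).
  assert (0 < N * sqrt t) by nra. nra.
Qed.

(** Subtracting the two functions eliminates [u] and leaves [(t - t') * phi]. *)
Lemma lipschitz_at_unique_scale L p u (phi : C -> R) t t' :
  lipschitz_at L p (fun z => Cplus (u z) (RtoC (t * phi z))) ->
  lipschitz_at L p (fun z => Cplus (u z) (RtoC (t' * phi z))) ->
  t <> t' -> lipschitz_at L p (fun z => RtoC (phi z)).
Proof.
  intros (K & d & Hd & H) (K' & d' & Hd' & H') Ht.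
  exists ((K + K') * / Rabs (t - t')), (Rmin d d'); split; [apply Rmin_pos; auto|].
  intros w Lw Hw.
  specialize (H w Lw (Rlt_le_trans _ _ _ Hw (Rmin_l _ _))).
  specialize (H' w Lw (Rlt_le_trans _ _ _ Hw (Rmin_r _ _))).
  assert (Hp : 0 < Rabs (t - t')) by (apply Rabs_pos_lt; lra).
  apply Rmult_le_reg_l with (1 := Hp).
  replace (Rabs (t - t') * ((K + K') * / Rabs (t - t') * Cmod (Cminus w p))) with
    (K * Cmod (Cminus w p) + K' * Cmod (Cminus w p)) by (field; lra).
  set (x := Cminus _ _) in H. set (y := Cminus _ _) in H'.
  eapply Rle_trans; [|apply Rplus_le_compat; [exact H | exact H']].
  rewrite <- Cmod_R, <- Cmod_mult, <- (Cmod_opp y).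
  eapply Rle_trans; [|apply Cmod_triangle].
  right. f_equal. unfold x, y. rewrite RtoC_minus, !RtoC_mult. ring.
Qed.

(** * Density and the G_delta property *)

Lemma lipschitz_at_extendable L p r z0 (F u : C -> C) :
  Cmod (Cminus p z0) < r -> L p -> C_differentiable_at F p ->
  (forall z, Cin_disk z0 r z -> L z -> F z = u z) -> lipschitz_at L p u.
Proof.
  intros Hp Lp HF Hu. apply C_differentiable_at_cdiff in HF. destruct HF as [l Hl].
  destruct (cdiff_lipschitz_at L p F l Hl) as (K & d & Hd & HK).
  exists K, (Rmin d (r - Cmod (Cminus p z0))); split; [apply Rmin_pos; lra|].
  intros w Lw Hw.
  assert (W1 := Rlt_le_trans _ _ _ Hw (Rmin_l _ _)).
  assert (W2 := Rlt_le_trans _ _ _ Hw (Rmin_r _ _)).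
  rewrite <- (Hu w), <- (Hu p); auto; unfold Cin_disk; rewrite Cdist_Cmod; auto.
  generalize (Cmod_triangle_minus w p z0); lra.
Qed.

Lemma Ccontinuous_on_plus_cusp_series L zs t (u : C -> C) : 0 < t -> Ccontinuous_on L u ->
  Ccontinuous_on L (fun z => Cplus (u z) (RtoC (t * cusp_series zs z))).
Proof.
  intros Ht Hu z Lz eps He.
  destruct (Hu z Lz (eps / 2)) as (d & Hd & K); [lra|].
  (* The Hölder constant 4/3 makes the second contribution at most [t * (4 / 3 * s) = eps / 3],
     below the remaining [eps / 2]. *)
  set (s := eps / (4 * t)).
  assert (Hs : 0 < s) by (apply Rdiv_lt_0_compat; lra).
  exists (Rmin d (s * s)); split; [apply Rmin_pos; nra|].
  intros w Lw Hw.
  specialize (K w Lw (Rlt_le_trans _ _ _ Hw (Rmin_l _ _))).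
  assert (W := Rlt_le_trans _ _ _ Hw (Rmin_r _ _)).
  rewrite Cdist_Cmod in *.
  assert (Hsq : sqrt (Cmod (Cminus w z)) < s).
  { rewrite <- (sqrt_square s) by lra. apply sqrt_lt_1; try nra. apply Cmod_ge_0. }
  assert (Hh := cusp_series_holder zs z w).
  replace (Cminus (Cplus (u w) (RtoC (t * cusp_series zs w))) (Cplus (u z) (RtoC (t * cusp_series zs z))))
    with (Cplus (Cminus (u w) (u z)) (RtoC (t * (cusp_series zs w - cusp_series zs z)))).
  2:{ rewrite !RtoC_mult, RtoC_minus. ring. }
  eapply Rle_lt_trans; [apply Cmod_triangle|].
  rewrite Cmod_R, Rabs_mult, (Rabs_pos_eq t) by lra.
  assert (Es : t * s = eps / 4) by (unfold s; field; lra).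
  assert (t * Rabs (cusp_series zs w - cusp_series zs z) <= t * (4 / 3 * s)).
  { apply Rmult_le_compat_l; lra. }
  lra.
Qed.

Theorem nowhere_extendable_dense (L : C -> Prop) : (exists z, L z) -> Cno_isolated_points L ->
  CL_dense L (nowhere_holomorphically_extendable L).
Proof.
  intros Hne Hiso u K eps Hu HK HKL He.
  destruct (dense_sequence_exists L Hne) as (zs & HzL & Hzd).
  set (v := fun (t : R) (z : C) => Cplus (u z) (RtoC (t * cusp_series zs z))).
  (* At most one scale is bad at [zs k]; if there is none, 0 is a harmless default, and the bad
     scales form a sequence in either case. *)
  assert (Hbad : forall k, exists s, forall t, lipschitz_at L (zs k) (v t) -> t = s).
  { intros k. destruct (classic (exists s, lipschitz_at L (zs k) (v s))) as [[s Hs]|h].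
    - exists s; intros t Ht. apply NNPP; intros Hts.
      apply (cusp_series_not_lipschitz_at L zs k).
      + intros e Hee. destruct (Hiso (zs k) (HzL k) e Hee) as (w & h1 & h2 & h3).
        exists w; rewrite Cdist_Cmod in h3; auto.
      + apply (lipschitz_at_unique_scale L (zs k) u _ t s Ht Hs Hts).
    - exists 0; intros t Ht. exfalso; apply h; exists t; auto. }
  (* The series is bounded by 4/3, so [t < eps / 2] moves [u] by less than [eps] everywhere,
     whatever the compact set [K]. *)
  destruct (interval_avoids_sequence
    (fun k => proj1_sig (constructive_indefinite_description _ (Hbad k))) 0 (eps / 2))
    as (t & Ht & Hts); [lra|].
  exists (v t).
  assert (Hc : Ccontinuous_on L (v t)) by (apply Ccontinuous_on_plus_cusp_series; auto; lra).
  repeat split; auto.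
  - intros (z0 & r & F & Lz0 & Hr & HF & HFv).
    destruct (Hzd z0 r Lz0 Hr) as [k Hk].
    apply (Hts k).
    apply (proj2_sig (constructive_indefinite_description _ (Hbad k))).
    apply (lipschitz_at_extendable L (zs k) r z0 F (v t)); auto.
    apply HF. unfold Cin_disk. rewrite Cdist_Cmod. exact Hk.
  - intros z _. rewrite Cdist_Cmod. unfold v.
    replace (Cminus (Cplus (u z) (RtoC (t * cusp_series zs z))) (u z))
      with (RtoC (t * cusp_series zs z)) by ring.
    rewrite Cmod_R, Rabs_mult, (Rabs_pos_eq t) by lra.
    assert (Hb := proj2 (cusp_term_sum zs z)).
    assert (t * Rabs (cusp_series zs z) <= t * (4 / 3 * 1)) by (apply Rmult_le_compat_l; lra).
    lra.
Qed.

(** One index [m] controls both radius and bound: increasing it shrinks the disk and relaxes the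
    bound, each of which weakens the condition. *)
Definition boundedly_extendable (L : C -> Prop) (a : C) (m : nat) (u : C -> C) : Prop :=
  exists F F', quad_approx a (/ (INR m + 1)) (INR m) F F' /\
    forall z, Cmod (Cminus z a) < / (INR m + 1) -> L z -> F z = u z.

Lemma compact_closed_disk_inter (L : C -> Prop) (a : C) (r : R) : Cclosed_set L ->
  Ccompact_set (fun z => L z /\ Cmod (Cminus z a) <= r).
Proof.
  intros HL; split.
  - intros z Hz; split.
    + apply HL. intros eps He. destruct (Hz eps He) as (w & [h1 _] & h2). exists w; auto.
    + apply le_epsilon. intros eps He. destruct (Hz eps He) as (w & [_ h1] & h2).
      rewrite Cdist_Cmod in h2.
      generalize (Cmod_triangle_minus z w a). rewrite (Cmod_minus_sym z w). lra.
  - exists (r + Cmod a). intros z [_ Hz]. rewrite Cnorm_Cmod.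
    generalize (Cmod_minus_ge z a); lra.
Qed.

(** Otherwise [u] is approximated, within [/ (INR n + 1)] on the part of [L] in the closed disk, by
    boundedly extendable functions. An ultralimit of their extensions satisfies the same bounds and
    agrees with [u]. The closed disk enters because neighbourhoods in [C(L)] are tested on compact
    sets. *)
Lemma not_boundedly_extendable_open (L : C -> Prop) (a : C) (m : nat) : Cclosed_set L ->
  CL_open L (fun u => ~ boundedly_extendable L a m u).
Proof.
  intros HL u Hu Hnot. apply NNPP; intros Hno. apply Hnot.
  set (r := / (INR m + 1)).
  assert (Hv : forall n : nat, exists v, boundedly_extendable L a m v /\
    Cclose_on (fun z => L z /\ Cmod (Cminus z a) <= r) (/ (INR n + 1)) u v).
  { intros n. apply NNPP; intros Hn. apply Hno.
    exists (fun z => L z /\ Cmod (Cminus z a) <= r), (/ (INR n + 1)).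
    split; [apply (compact_closed_disk_inter L a r HL)|]. repeat split.
    - intros z [h _]; exact h.
    - apply Rinv_0_lt_compat. generalize (pos_INR n); lra.
    - intros v _ Hcl Hbe. apply Hn. exists v; auto. }
  assert (HF : forall n : nat, exists FF : (C -> C) * (C -> C),
    quad_approx a r (INR m) (fst FF) (snd FF) /\
    forall z, Cmod (Cminus z a) < r -> L z -> Cmod (Cminus (fst FF z) (u z)) < / (INR n + 1)).
  { intros n. destruct (Hv n) as (v & (F & F' & HQ & HFv) & Hcl).
    exists (F, F'); split; auto. intros z Hz Lz. simpl. rewrite (HFv z Hz Lz).
    rewrite <- Cdist_Cmod. apply Hcl. split; auto. lra. }
  pose (FF := fun n => proj1_sig (constructive_indefinite_description _ (HF n))).
  assert (HFF := fun n => proj2_sig (constructive_indefinite_description _ (HF n))).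
  fold FF in HFF. cbv beta in HFF.
  destruct free_ultrafilter_exists as [U HU].
  destruct (quad_approx_ultralimit U a r (INR m) (fun n => fst (FF n)) (fun n => snd (FF n)) HU)
    as (F & F' & HQ & Hlim); [intros n; apply (HFF n)|].
  exists F, F'; split; [exact HQ|].
  intros z Hz Lz. apply (ulim_unique U HU (fun n => fst (FF n) z)); [apply Hlim, Hz|].
  intros eps He. destruct (inv_INR_S_small eps He) as [N HN].
  apply (uf_mono U HU) with (2 := uf_free U HU N).
  intros n Hn. eapply Rlt_trans; [apply (HFF n); auto|].
  eapply Rle_lt_trans; [|exact HN].
  apply Rinv_le_contravar; [generalize (pos_INR N); lra|].
  apply Rplus_le_compat_r, le_INR, Hn.
Qed.

(** The index [n] codes a centre [zs k] and a bound [m]. That [zs k] lies in [L] makes bounded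
    extendability there a violation of nowhere extendability; conversely, a disk of extension around
    any point of [L] contains a small disk around some [zs k]. *)
Theorem nowhere_extendable_Gdelta (L : C -> Prop) : (exists z, L z) -> Cclosed_set L ->
  CL_Gdelta L (nowhere_holomorphically_extendable L).
Proof.
  intros Hne HL.
  destruct (dense_sequence_exists L Hne) as (zs & HzL & Hzd).
  exists (fun n u => ~ boundedly_extendable L (zs (fst (Cantor.of_nat n))) (snd (Cantor.of_nat n)) u).
  split; [intros n; apply not_boundedly_extendable_open, HL|].
  intros v Hv; split.
  - intros [_ Hno] n (F & F' & HQ & HFv). apply Hno.
    set (k := fst (Cantor.of_nat n)) in *. set (m := snd (Cantor.of_nat n)) in *.
    exists (zs k), (/ (INR m + 1)), F. repeat split; auto.
    + apply Rinv_0_lt_compat. generalize (pos_INR m); lra.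
    + intros z Hz. unfold Cin_disk in Hz; rewrite Cdist_Cmod in Hz.
      apply C_differentiable_at_cdiff. eexists. eapply quad_approx_cdiff; eauto.
    + intros z Hz Lz. unfold Cin_disk in Hz; rewrite Cdist_Cmod in Hz. auto.
  - intros Hall; split; auto. intros (z0 & r & F & Lz0 & Hr & HF & HFv).
    destruct (cdiff_quad_approx F z0 r Hr) as (M & F' & HQ).
    { intros w Hw. apply C_differentiable_at_cdiff, HF.
      unfold Cin_disk; rewrite Cdist_Cmod; exact Hw. }
    (* The bounds hold on radius [r / 4]; half of it is spent on the distance from [z0] to [zs k],
       half on the new radius. In [m], the summand [m1] makes the radius small and [m2] exceeds
       [M]. *)
    destruct (Hzd z0 (r / 8) Lz0) as [k Hk]; [lra|].
    destruct (inv_INR_S_small (r / 8)) as [m1 Hm1]; [lra|].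
    destruct (INR_unbounded M) as [m2 Hm2].
    set (m := (m1 + m2)%nat).
    assert (Hm : / (INR m + 1) < r / 8).
    { eapply Rle_lt_trans; [|exact Hm1]. apply Rinv_le_contravar.
      - generalize (pos_INR m1); lra.
      - apply Rplus_le_compat_r, le_INR. unfold m; lia. }
    assert (HmM : M <= INR m).
    { apply Rle_trans with (INR m2); [lra|]. apply le_INR; unfold m; lia. }
    apply (Hall (Cantor.to_nat (k, m))). rewrite Cantor.cancel_of_to. simpl fst; simpl snd.
    exists F, F'; split.
    + apply quad_approx_weaken with (1 := HQ); lra.
    + intros z Hz Lz. apply HFv; auto. unfold Cin_disk; rewrite Cdist_Cmod.
      generalize (Cmod_triangle_minus z (zs k) z0); lra.
Qed.

Theorem theorem6p4 (L : Cpx -> Prop) :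
  (exists z : Cpx, L z) -> Cclosed_set L -> Cno_isolated_points L ->
  CL_dense L (nowhere_holomorphically_extendable L) /\
  CL_Gdelta L (nowhere_holomorphically_extendable L).
Proof.
  intros Hne HL Hiso; split.
  - apply nowhere_extendable_dense; auto.
  - apply nowhere_extendable_Gdelta; auto.
Qed.
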